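(* Let $F\in V'$ with $F\ge0$. Suppose that: (i) the sequence $\{f_n\}$ in $H^+$, with $0\le f_n\le F$ for all $n\in\mathbb{N}$, is non-decreasing and $\lim_{n\to\infty}f_n=f^*$ in $H$ for some $f^*\in H$; (ii) the increasing map $\Phi:H^+\to H^+$ satisfies Assumption (A) (stated in the context). Then $$\mathbf{m}(f_n)\uparrow\mathbf{m}(f^* )\ \text{in } H,\quad\text{and}\quad\mathbf{m}(f_n)\to\mathbf{m}(f^* )\ \text{in } V.$$
   Context: $(V,H,V')$ is a Gelfand triple of Hilbert spaces: $V\hookrightarrow H\hookrightarrow V'$ with dense and continuous embeddings, $H$ identified with $H'$; $\langle\cdot,\cdot\rangle$ is the duality pairing of $V'$ and $V$, $(\cdot,\cdot)$ the inner product of $H$. $H^+\subset H$ is a closed convex cone with $H^+=\{v\in H:(v,y)\ge0\ \forall y\in H^+\}$, and $x\le y$ means $y-x\in H^+$. For $x\in H$, $x^+$ is the orthogonal projection of $x$ onto $H^+$ and $x^-:=x^+-x$; $\sup(x,y):=x+(y-x)^+$, $\inf(x,y):=x-(x-y)^+$. It is assumed that $y\in V$ implies $y^+\in V$, and $\|y^+\|_V\le M\|y\|_V$ for all $y\in V$ and some $M>0$. $V$ and $H$ are spaces of functions $h:\Omega\to\mathbb{R}$ on an open set $\Omega\subset\mathbb{R}^N$, with $L^\infty(\Omega)\hookrightarrow H$ densely and continuously, and $L^\infty(\Omega)$ inherits the order of $H$ (prototype: $V=H_0^1(\Omega)$, $H=L^2(\Omega)$, $H^+$ the a.e. non-negative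 functions). In $V'$, $f_1\le f_2$ means $\langle f_2-f_1,v\rangle\ge0$ for all $v\in V$ with $v\ge0$. For a fixed $\nu>0$, $L^\infty_\nu(\Omega):=\{z\in L^\infty(\Omega): z(x)\ge\nu \text{ for a.a. } x\in\Omega\}$. For $x\le y$ in $H$, $[x,y]:=\{z\in H:x\le z\le y\}$. $z_n\uparrow z$ in $H$ means $z_n\le z_{n+1}$ for all $n$ and $z_n\to z$ in $H$. $A:V\to V'$ (possibly nonlinear) is: homogeneous of order one ($A(tu)=tA(u)$ for $u\in V$, $t>0$); Lipschitz continuous ($\|A(u)-A(v)\|_{V'}\le C\|u-v\|_V$); strongly monotone ($\langle A(u)-A(v),u-v\rangle\ge c\|u-v\|_V^2$ for some $c>0$); and T-monotone ($\langle A(u)-A(v),(u-v)^+\rangle\ge0$ for all $u,v\in V$, with equality if and only if $(u-v)^+=0$). $\Phi:H^+\to H^+$ is increasing ($0\le v\le w$ implies $\Phi(v)\le\Phi(w)$), extended to $H$ by $x\mapsto\Phi(x^+)$ when needed. For $\psi\in H^+$, $\mathbf{K}(\psi):=\{v\in V:v\le\psi\}$; for $f\in V'$, $S(f,\psi)$ is the unique $y\in\mathbf{K}(\psi)$ with $\langle A(y)-f,v-y\rangle\ge0$ for all $v\in\mathbf{K}(\psi)$. Let $\overline{y}\in V$ be the unique solution of $A(\overline{y})=F$. For $f\in V'$ with $0\le f\le F$, the set of fixed points of $y\mapsto S(f,\Phi(y))$ in $[0,\overline{y}]$ is non-empty and has a smallest element, denoted $\mathbf{m}(f)$. Assumption (A):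 $\Phi$ satisfies one of the following. (a) Whenever $v_n\rightharpoonup v$ in $V$, either $\Phi(v_n)\to\Phi(v)$ in $L^\infty_\nu(\Omega)$ (i.e. these elements lie in $L^\infty_\nu(\Omega)$ and converge in $L^\infty(\Omega)$), or $\Phi(v_n)\to\Phi(v)$ in $V$. (b) Whenever $v_n\rightharpoonup v$ in $V$, $\Phi(v_n)\to\Phi(v)$ in $H$; and there is a strongly monotone $\mathcal{Q}\in\mathscr{L}(V,V')$ (bounded linear) with $\langle\mathcal{Q}v^-,v^+\rangle\le0$ for all $v\in V$ such that for every $v\in V\cap H^+$ one has $\Phi(v)\in V$ and $\mathcal{Q}\Phi(v)\ge0$ in $V'$.
   Formalization: The order of H is assumed to be a lattice order: sup(x,y)=x+(y-x)^+ and inf(x,y)=x-(x-y)^+ are required to be the least upper and greatest lower bounds. Self-duality of H^+ does not imply this, and the claim fails without it (e.g. for a positive semidefinite matrix factor). *)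

(* Defs.v *)
From HB Require Import structures.
From mathcomp Require Import all_boot all_order all_algebra.
From mathcomp Require Import sesquilinear lra.
From mathcomp Require Import all_classical all_reals all_analysis.

Set Implicit Arguments.
Unset Strict Implicit.
Unset Printing Implicit Defensive.

Import Order.TTheory GRing.Theory Num.Theory.
Import numFieldNormedType.Exports.

Local Open Scope classical_set_scope.
Local Open Scope ring_scope.

(** * Lebesgue measure on R^N, N >= 1 *)

Section lebesgue_rV.
Context (R : realType) (N : nat).
Local Notation RN := 'rV[R]_N.+1.
Local Open Scope ereal_scope.

Definition box (ab : RN * RN) : set RN :=
  [set x | forall i, (ab.1 ord0 i <= x ord0 i < ab.2 ord0 i)%R].

Definition box_volume (ab : RN * RN) : \bar R :=
  (\prod_i Num.max 0 (ab.2 ord0 i - ab.1 ord0 i))%R%:E.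

Definition lebesgue_outer (X : set RN) : \bar R :=
  ereal_inf [set \sum_(k <oo) box_volume (c k)
            | c in [set c : (RN * RN)^nat | X `<=` \bigcup_k box (c k)]].

Lemma box_volume_ge0 ab : 0 <= box_volume ab.
Proof. by rewrite lee_fin; apply: prodr_ge0 => i _; rewrite le_max lexx. Qed.

Lemma lebesgue_outer_ge0 X : 0 <= lebesgue_outer X.
Proof.
apply: le_ereal_inf_tmp => _ [c _ <-].
by apply: nneseries_ge0 => k *; exact: box_volume_ge0.
Qed.

Lemma le_lebesgue_outer : {homo lebesgue_outer : A B / A `<=` B >-> A <= B}.
Proof.
move=> A B AB; apply/ereal_inf_le_tmp => _ [c Bc <-]; exists c => //.
exact: subset_trans Bc.
Qed.

Lemma lebesgue_outer0 : lebesgue_outer set0 = 0.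
Proof.
apply/eqP; rewrite eq_le lebesgue_outer_ge0 andbT.
apply: ereal_inf_lbound; exists (fun=> (0%R, 0%R)); first by move=> ?.
rewrite eseries0// => k _ _; rewrite /box_volume/= (bigD1 ord0)//=.
by rewrite mxE subrr maxxx mul0r.
Qed.

Lemma lebesgue_outer_sigma_subadditive : sigma_subadditive lebesgue_outer.
Proof.
move=> A; have [[i ioo]|] := pselect (exists i, lebesgue_outer (A i) = +oo).
  rewrite (eseries_pinfty _ _ ioo) ?leey// => n _.
  by rewrite -ltNye (lt_le_trans _ (lebesgue_outer_ge0 _)).
rewrite -forallNE => Aoo.
suff add2e (e : {posnum R}) : lebesgue_outer (\bigcup_n A n) <=
    \sum_(i <oo) lebesgue_outer (A i) + e%:num%:E.
  by apply/lee_addgt0Pr => _/posnumP[].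
rewrite (le_trans _ (epsilon_trick _ _ _))//; last first.
  by move=> n; exact: lebesgue_outer_ge0.
pose P n (c : (RN * RN)^nat) := A n `<=` \bigcup_k box (c k) /\
  \sum_(k <oo) box_volume (c k) <=
    lebesgue_outer (A n) + (e%:num / (2 ^ n.+1)%:R)%:E.
have [G PG] : {G : ((RN * RN)^nat)^nat & forall n, P n (G n)}.
  apply: (@choice _ _ P) => n; rewrite /P /lebesgue_outer.
  set S := (X in ereal_inf X); move infS : (ereal_inf S) => iS.
  case: iS infS => [r Sr|Soo|Soo].
  - have en1 : (0 < e%:num / (2 ^ n.+1)%:R)%R by [].
    have /(lb_ereal_inf_adherent en1) : ereal_inf S \is a fin_num by rewrite Sr.
    move=> [x [c Ac cx] xS].
    by exists c; split => //; rewrite cx -Sr; exact/ltW.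
  - by have := Aoo n; rewrite /lebesgue_outer Soo.
  - by have := lebesgue_outer_ge0 (A n); rewrite /lebesgue_outer Soo.
pose v := box_volume \o uncurry G.
have v_ge0 x : 0 <= v x by exact: box_volume_ge0.
apply: (@le_trans _ _ (\esum_(i in setT) v i)).
  apply: ereal_inf_lbound => /=.
  have /card_esym/ppcard_eqP[f] := card_nat2.
  exists (uncurry G \o f).
    move=> t [i _ Ait]; have [j _ Bijt] := (PG i).1 _ Ait.
    by exists (f^-1%FUN (i, j)) => //=; rewrite invK ?inE.
  rewrite -(esum_pred_image v _ xpredT) ?[fun=> _]set_true//.
  by rewrite image_eq.
rewrite (_ : esum _ _ = \sum_(i <oo) \sum_(j <oo) box_volume (G i j)).
  apply: lee_lim.
  - apply: is_cvg_nneseries => n *.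
    by apply: nneseries_ge0 => m *; exact: (v_ge0 (n, m)).
  - by apply: is_cvg_nneseries => n *; apply: adde_ge0 => //;
      exact: lebesgue_outer_ge0.
  - by near=> n; apply: lee_sum => i _; exact: (PG i).2.
pose J : nat -> set (nat * nat) := fun i => [set (i, j) | j in setT].
rewrite (_ : setT = \bigcup_k J k); last first.
  by rewrite predeqE => -[a b]; split => // _; exists a => //; exists b.
rewrite esum_bigcupT /=; last 2 first.
  - apply/trivIsetP => i j _ _ ij.
    rewrite predeqE => -[n m] /=; split => //= -[] [_] _ [<-{n} _].
    by move=> [m' _] [] /esym/eqP; rewrite (negbTE ij).
  - by move=> x; exact: v_ge0.
rewrite -(image_id [set: nat]) -fun_true esum_pred_image//; last first.
  by move=> n _; apply: esum_ge0 => x _; exact: v_ge0.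
apply: eq_eseriesr => /= j _.
rewrite -(esum_pred_image v (pair j) predT)//=; last first.
  by move=> ? ? _ _; exact: (@can_inj _ _ _ snd).
by congr esum; rewrite predeqE => -[a b]; split; move=> [i _ <-]; exists i.
Unshelve. all: by end_near. Qed.

HB.instance Definition _ := isOuterMeasure.Build R RN lebesgue_outer
  lebesgue_outer0 lebesgue_outer_ge0 le_lebesgue_outer
  lebesgue_outer_sigma_subadditive.

Definition lebesgue_outer_measure : {outer_measure set RN -> \bar R} :=
  lebesgue_outer.

(* on the sigma-algebra of Caratheodory-measurable (i.e., Lebesgue) sets *)
Definition lebesgueN :
    {measure set (caratheodory_type lebesgue_outer_measure) -> \bar R} :=
  (lebesgue_outer_measure :
    set (caratheodory_type lebesgue_outer_measure) -> \bar R).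

End lebesgue_rV.

(** * L^oo(Omega) *)

Section Linfty.
Context (R : realType) (N : nat) (Omega : set 'rV[R]_N.+1).
Implicit Types z : 'rV[R]_N.+1 -> R.
Local Notation lambda := (@lebesgueN R N).

(* only the values on Omega matter: functions are extended by 0 *)
Definition in_Linfty z := (z \_ Omega) \in Lfun lambda +oo%E.

Definition Linfty_norm z : \bar R := Lnorm lambda +oo%E (EFin \o (z \_ Omega)).

Definition in_Linfty_nu (nu : R) z :=
  in_Linfty z /\ {ae lambda, forall x, Omega x -> nu <= z x}.

End Linfty.

(** * Hilbert spaces and topological duals *)

Record inner_product (R : realType) (U : normedModType R) := InnerProduct {
  ip :> {dot U for idfun};
  ip_norm : forall u, ip u u = `|u| ^+ 2 }.

Section dual.
Context (R : realType) (U : normedModType R).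

Definition continuous_functional : {pred U -> R^o} :=
  [pred g | `[< linear g /\ continuous g >]].

Lemma continuous_functional_submod : submod_closed continuous_functional.
Proof.
split; first by apply/asboolP; split;
  [move=> a u v /=; rewrite scaler0 addr0|move=> x; exact: cvg_cst].
move=> a f g /asboolP[lf cf] /asboolP[lg cg]; apply/asboolP; split.
  move=> b u v; rewrite !fctE /= lf lg !scalerDr !scalerA.
  by rewrite (mulrC b a) -!addrA; congr (_ + _); rewrite addrCA.
move=> x; apply: (@cvgD _ R^o _ _ _ (fun x => a *: f x) g).
  by apply: cvgZr; exact: cf.
exact: cg.
Qed.

HB.instance Definition _ := GRing.isSubmodClosed.Build R (U -> R^o)
  continuous_functional continuous_functional_submod.

Record dual := Dual {
  functional :> U -> R^o;
  functionalP : functional \in continuous_functional }.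

HB.instance Definition _ := [isSub for functional].
HB.instance Definition _ := [Choice of dual by <:].
HB.instance Definition _ := [SubChoice_isSubLmodule of dual by <:].

Definition dual_norm (g : dual) : R :=
  sup [set `|g u| | u in [set u : U | `|u| <= 1]].

Definition weakly_converges (u_ : U^nat) (u : U) :=
  forall g : dual, g (u_ n) @[n --> \oo] --> g u.

End dual.

(** * Gelfand triples *)

Record gelfand_triple (R : realType) (V H : completeNormedModType R) :=
  GelfandTriple {
    ipV : inner_product V;
    ipH : inner_product H;
    emb : {linear V -> H};
    emb_inj : injective emb;
    emb_continuous : continuous emb;
    emb_dense : dense (range emb) }.

Section embedding_in_dual.
Context (R : realType) (V H : completeNormedModType R).
Variable T : gelfand_triple V H.

Lemma ip_emb_functional h :
  (fun v => ipH T h (emb T v)) \in continuous_functional (U := V).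
Proof.
apply/asboolP; split; first by move=> a u v; rewrite !linearP.
have -> : (fun v => ipH T h (emb T v) : R^o) =
    (fun v => 2^-1 * (`|h + emb T v| ^+ 2 - `|h| ^+ 2 - `|emb T v| ^+ 2)).
  apply/funext => v; rewrite -!(ip_norm (ipH T)) hnormD /= expr0 mul1r.
  by lra.
move=> v; apply: cvgM; first exact: cvg_cst.
have eT := @emb_continuous _ _ _ T v.
apply: cvgB; last by under eq_fun do rewrite expr2; rewrite expr2;
  apply: cvgM; apply: cvg_norm.
apply: cvgB; last exact: cvg_cst.
under eq_fun do rewrite expr2; rewrite expr2.
by apply: cvgM; apply: cvg_norm; apply: cvgD => //; exact: cvg_cst.
Qed.

Definition H_to_dual (h : H) : dual V := Dual (ip_emb_functional h).

End embedding_in_dual.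

(** * Order *)

Section cone_operations.
Context (R : realType) (H : normedModType R) (K : set H).

Definition le_H (x y : H) := K (y - x).

(* metric projection onto K *)
Definition pos_part (x : H) : H :=
  xget 0 [set p | K p /\ forall q, K q -> `|x - p| <= `|x - q|].

Definition neg_part (x : H) : H := pos_part x - x.

Definition sup_H (x y : H) : H := x + pos_part (y - x).

Definition inf_H (x y : H) : H := x - pos_part (x - y).

Definition increases_to (x_ : H^nat) (x : H) :=
  (forall n, le_H (x_ n) (x_ n.+1)) /\ x_ n @[n --> \oo] --> x.

End cone_operations.

Record lattice_cone (R : realType) (V H : completeNormedModType R)
    (T : gelfand_triple V H) := LatticeCone {
  cone :> set H;
  cone_closed : closed cone;
  cone_add : forall x y, cone x -> cone y -> cone (x + y);
  cone_scale : forall t x, 0 <= t -> cone x -> cone (t *: x);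
  cone_selfdual : cone = [set v | forall y, cone y -> 0 <= ipH T v y];
  (* [sup_H] and [inf_H] are the lattice operations of the order; this does not
     follow from self-duality (e.g. for the Lorentz cone in R^3) *)
  cone_sup_ub : forall x y,
    le_H cone x (sup_H cone x y) /\ le_H cone y (sup_H cone x y);
  cone_sup_least : forall x y z,
    le_H cone x z -> le_H cone y z -> le_H cone (sup_H cone x y) z;
  cone_inf_lb : forall x y,
    le_H cone (inf_H cone x y) x /\ le_H cone (inf_H cone x y) y;
  cone_inf_greatest : forall x y z,
    le_H cone z x -> le_H cone z y -> le_H cone z (inf_H cone x y);
  (* v |-> v^+ maps V to V and is bounded there *)
  posV : V -> V;
  emb_posV : forall v, emb T (posV v) = pos_part cone (emb T v);
  posV_bounded : exists2 M, 0 < M & forall v, `|posV v| <= M * `|v| }.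

Definition negV (R : realType) (V H : completeNormedModType R)
  (T : gelfand_triple V H) (K : lattice_cone T) (v : V) : V := posV K v - v.

Definition le_dual (R : realType) (V H : completeNormedModType R)
    (T : gelfand_triple V H) (K : lattice_cone T) (f g : dual V) :=
  forall v, cone K (emb T v) -> 0 <= (g - f) v.

(** * H as a space of functions on Omega *)

(* [rep h] is a representative of the a.e.-class of functions that h is; the
   elements of L^oo(Omega) in H are the h such that [rep h] is in L^oo(Omega) *)
Record function_space (R : realType) (V H : completeNormedModType R)
    (T : gelfand_triple V H) (K : lattice_cone T)
    (N : nat) (Omega : set 'rV[R]_N.+1) := FunctionSpace {
  rep : H -> 'rV[R]_N.+1 -> R;
  rep_linear : forall a h k, {ae @lebesgueN R N, forall x, Omega x ->
    rep (a *: h + k) x = a * rep h x + rep k x};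
  rep_inj : forall h,
    {ae @lebesgueN R N, forall x, Omega x -> rep h x = 0} -> h = 0;
  Linfty_sub : forall z, in_Linfty Omega z ->
    exists h, {ae @lebesgueN R N, forall x, Omega x -> rep h x = z x};
  Linfty_continuous : exists C, forall h, in_Linfty Omega (rep h) ->
    `|h| <= C * fine (Linfty_norm Omega (rep h));
  Linfty_dense : dense [set h | in_Linfty Omega (rep h)];
  Linfty_order : forall h, in_Linfty Omega (rep h) ->
    (cone K h <-> {ae @lebesgueN R N, forall x, Omega x -> 0 <= rep h x}) }.

(** * Operators and quasi-variational inequalities *)

Section qvi.
Context (R : realType) (V H : completeNormedModType R).
Context (T : gelfand_triple V H) (K : lattice_cone T).
Implicit Types (A : V -> dual V) (Phi : H -> H) (f : dual V).

Definition homogeneous1 A := forall t u, 0 < t -> A (t *: u) = t *: A u.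

Definition lipschitz_dual A :=
  exists C, forall u v, dual_norm (A u - A v) <= C * `|u - v|.

Definition strongly_monotone A :=
  exists2 c, 0 < c & forall u v, c * `|u - v| ^+ 2 <= (A u - A v) (u - v).

Definition T_monotone A := forall u v,
  0 <= (A u - A v) (posV K (u - v)) /\
  ((A u - A v) (posV K (u - v)) = 0 <-> posV K (u - v) = 0).

Definition obstacle_set (psi : H) : set V := [set v | le_H K (emb T v) psi].

(* the solution of the variational inequality with obstacle psi *)
Definition VI_solution A f (psi : H) : V :=
  xget 0 [set y | obstacle_set psi y /\
    forall v, obstacle_set psi v -> 0 <= (A y - f) (v - y)].

Definition increasing_on_cone Phi :=
  (forall v, cone K v -> cone K (Phi v)) /\
  (forall v w, cone K v -> le_H K v w -> le_H K (Phi v) (Phi w)).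

Definition extend Phi (x : H) : H := Phi (pos_part K x).

Definition fixed_points A Phi (ybar : V) f : set V :=
  [set y | [/\ le_H K 0 (emb T y), le_H K (emb T y) (emb T ybar) &
               y = VI_solution A f (extend Phi (emb T y))]].

(* the smallest fixed point in [0, ybar] *)
Definition smallest_fixed_point A Phi (ybar : V) f : V :=
  xget 0 [set y | fixed_points A Phi ybar f y /\
    forall z, fixed_points A Phi ybar f z -> le_H K (emb T y) (emb T z)].

Definition converges_in_V (h_ : H^nat) (h : H) :=
  exists (w_ : V^nat) (w : V), [/\ forall n, emb T (w_ n) = h_ n,
    emb T w = h & w_ n @[n --> \oo] --> w].

Definition converges_in_Linfty_nu (N : nat) (Omega : set 'rV[R]_N.+1)
    (E : function_space K Omega) (nu : R) (h_ : H^nat) (h : H) :=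
  [/\ forall n, in_Linfty_nu Omega nu (rep E (h_ n)),
      in_Linfty_nu Omega nu (rep E h) &
      Linfty_norm Omega (fun x => rep E (h_ n) x - rep E h x) @[n --> \oo]
        --> 0%E].

Definition assumption_a (N : nat) (Omega : set 'rV[R]_N.+1)
    (E : function_space K Omega) (nu : R) Phi :=
  forall (v_ : V^nat) (v : V), weakly_converges v_ v ->
    let Phi_ n := extend Phi (emb T (v_ n)) in
    converges_in_Linfty_nu E nu Phi_ (extend Phi (emb T v)) \/
    converges_in_V Phi_ (extend Phi (emb T v)).

Definition assumption_b Phi :=
  (forall (v_ : V^nat) (v : V), weakly_converges v_ v ->
    extend Phi (emb T (v_ n)) @[n --> \oo] --> extend Phi (emb T v)) /\
  exists Q : {linear V -> dual V},
    [/\ exists C, forall v, dual_norm (Q v) <= C * `|v|,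
        strongly_monotone Q,
        forall v, Q (negV K v) (posV K v) <= 0 &
        forall v, cone K (emb T v) ->
          exists2 w, emb T w = Phi (emb T v) & le_dual K 0 (Q w)].

Definition assumption_A (N : nat) (Omega : set 'rV[R]_N.+1)
    (E : function_space K Omega) (nu : R) Phi :=
  assumption_a E nu Phi \/ assumption_b Phi.

End qvi.

(* Main.v *)
From HB Require Import structures.
Require Import Defs.
From mathcomp Require Import all_boot all_order all_algebra.
From mathcomp Require Import sesquilinear ring lra.
From mathcomp Require Import all_classical all_reals all_analysis.
From mathcomp Require Import measurable_realfun ess_sup_inf.

(** The order bounds make every nondecreasing sequence in [0, ybar] converge in
    H, since self-duality of the cone gives |y - x|^2 <= |y|^2 - |x|^2 for
    0 <= x <= y. If such a sequence y_n is moreover bounded in V, its limit y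
    lies in V and y_n converges weakly to y. Assumption (A) then yields recovery
    sequences for the obstacles Phi(y_n): by translation if Phi(y_n) converges
    in V, by scaling with 1 - e in the L^oo_nu case, and case (b) reduces to
    convergence in V because Q Phi(y_n) >= 0 and Phi(y_n) <= Phi(y). Hence
    S(f_n, Phi(y_n)) converges in V to S(f, Phi(y)). Applied to the iteration
    y_(k+1) = S(f, Phi(y_k)) from 0, this gives the smallest fixed point m(f),
    which is nondecreasing in f by T-monotonicity; applied to y_n = m(f_n), it
    shows that the limit is a fixed point for fstar, below m(fstar), hence equal
    to m(fstar). *)

Set Implicit Arguments.
Unset Strict Implicit.
Unset Printing Implicit Defensive.

Import Order.TTheory GRing.Theory Num.Theory.
Import numFieldNormedType.Exports.

Local Open Scope classical_set_scope.
Local Open Scope ring_scope.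

(** * Convergence criteria for sequences *)

Lemma dist_cvg0 (R : realType) (U : normedModType R) (u : U^nat) (l : U) :
  `|u n - l| @[n --> \oo] --> 0 -> u @ \oo --> l.
Proof.
move=> /cvgrPdist_lt ul; apply/cvgrPdist_lt => e /ul; apply: filterS => n.
by rewrite sub0r normrN normr_id distrC.
Qed.

Lemma sub_segment (R : realType) (U W : normedModType R) (f : {linear U -> W})
    (w : W) (t : R) (u v : U) :
  w - f (u + t *: (v - u)) = (1 - t) *: (w - f u) + t *: (w - f v).
Proof.
rewrite linearD linearZ linearB /= opprD addrA -scalerN opprB.
rewrite scalerBl scale1r -[RHS]addrA -scalerN -scalerDr opprB.
by congr (_ + _ *: _); rewrite addrA subrK.
Qed.

(** Squared, because Hilbert-space estimates come squared; a bound [d m] in one index is enough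
    since a ball centred at the earlier term [u m] contains the whole tail. *)
Lemma sqr_dist_cauchy (R : realType) (U : completeNormedModType R)
    (u : U^nat) (d : R^nat) :
  d @ \oo --> 0 -> (forall m k, (m <= k)%N -> `|u m - u k| ^+ 2 <= d m) ->
  cvgn u.
Proof.
move=> d0 du; apply/cauchy_cvgP/cauchy_exP => e e0.
have /cvgrPdist_lt /(_ _ (exprn_gt0 2 e0)) [m _ dm] := d0.
exists (u m), m => // k /= mk; rewrite -ball_normE /=.
rewrite -(ltr_pXn2r (n := 2)) ?nnegrE ?normr_ge0 ?(ltW e0)//.
apply: (le_lt_trans (du _ _ mk)).
by apply: (le_lt_trans (ler_norm _)); rewrite -normrN -sub0r; apply: dm => /=.
Qed.

Lemma nondecreasing_bounded_gap_cvg0 (R : realType) (d : R^nat) (M : R) :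
  {homo d : n m / (n <= m)%N >-> n <= m} -> (forall n, d n <= M) ->
  (forall n, d n <= limn d) /\ limn d - d n @[n --> \oo] --> 0.
Proof.
move=> nd dM.
have dc : cvgn d.
  by apply: nondecreasing_is_cvgn => //; exists M => _ [n _ <-].
split=> [n|]; first exact: nondecreasing_cvgn_le.
by rewrite -[X in _ --> X](subrr (limn d)); apply: cvgB => //; exact: cvg_cst.
Qed.

(** * Hilbert spaces *)

Section inner_product_theory.
Context (R : realType) (U : normedModType R) (B : inner_product U).
Implicit Types u v w : U.

Lemma ipC u v : ip B u v = ip B v u.
Proof. by rewrite hermC /= expr0 mul1r. Qed.

Lemma ipBl u v w : ip B (u - v) w = ip B u w - ip B v w.
Proof. exact: linearBl. Qed.

Lemma ipBr u v w : ip B u (v - w) = ip B u v - ip B u w.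
Proof. exact: linearBr. Qed.

Lemma ipZl a u v : ip B (a *: u) v = a * ip B u v.
Proof. exact: linearZl_LR. Qed.

Lemma ipZr a u v : ip B u (a *: v) = a * ip B u v.
Proof. exact: linearZr_LR. Qed.

Lemma ip_sqrD u v : `|u + v| ^+ 2 = `|u| ^+ 2 + ip B u v *+ 2 + `|v| ^+ 2.
Proof.
rewrite -!(ip_norm B) linearDl /= !linearDr /= (ipC v u) mulr2n.
by rewrite !addrA.
Qed.

Lemma ip_sqrB u v : `|u - v| ^+ 2 = `|u| ^+ 2 - ip B u v *+ 2 + `|v| ^+ 2.
Proof. by rewrite ip_sqrD normrN linearNr /= mulNrn. Qed.

Lemma ip_CauchySchwarz u v : ip B u v <= `|u| * `|v|.
Proof.
have : `|u + v| ^+ 2 <= (`|u| + `|v|) ^+ 2.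
  by rewrite ler_pXn2r ?nnegrE ?addr_ge0 ?ler_normD.
by rewrite ip_sqrD sqrrD; lra.
Qed.

Lemma ip_eq0 u : ip B u u <= 0 -> u = 0.
Proof.
rewrite ip_norm => u0; apply/eqP.
by rewrite -normr_eq0 -sqrf_eq0 eq_le u0 sqr_ge0.
Qed.

End inner_product_theory.

(** * Continuous linear functionals and the dual norm *)

Section dual_theory.
Context (R : realType) (U : normedModType R).
Implicit Types (g h : dual U) (u v : U).

Lemma dual_linear g : linear g.
Proof. by have /asboolP[] := functionalP g. Qed.

Lemma dual_continuous g : continuous g.
Proof. by have /asboolP[] := functionalP g. Qed.

HB.instance Definition _ g := GRing.isLinear.Build R U R^o _ g (dual_linear g).

Lemma dualD g u v : g (u + v) = g u + g v.
Proof. exact: linearD. Qed.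
Lemma dualN g u : g (- u) = - g u.
Proof. exact: linearN. Qed.
Lemma dualB g u v : g (u - v) = g u - g v.
Proof. exact: linearB. Qed.
Lemma dualZ g a u : g (a *: u) = a * g u.
Proof. exact: linearZ. Qed.
Lemma dual0 g : g 0 = 0.
Proof. exact: linear0. Qed.
Lemma dual_subE g h u : (g - h) u = g u - h u.
Proof. by []. Qed.
Lemma dual_scaleE a g u : (a *: g) u = a * g u.
Proof. by []. Qed.
Lemma dual_oppE g u : (- g) u = - g u.
Proof. by []. Qed.

Lemma dual_norm_ge0 g : 0 <= dual_norm g.
Proof.
have [[sne sub]|] :=
    pselect (has_sup [set `|g u| | u in [set u : U | `|u| <= 1]]).
  by apply: ub_le_sup => //; exists 0; rewrite /= ?normr0// dual0 normr0.
(* [sup] defaults to 0 on a set without a supremum. *)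
by move=> /sup_out; rewrite /dual_norm => ->.
Qed.

Lemma dual_norm_bound g u : `|g u| <= dual_norm g * `|u|.
Proof.
have [->|u0] := eqVneq u 0; first by rewrite dual0 !normr0 mulr0.
have un0 : 0 < `|u| by rewrite normr_gt0.
rewrite -ler_pdivrMr //.
have -> : `|g u| / `|u| = `|g (`|u|^-1 *: u)|.
  by rewrite dualZ normrM ger0_norm ?invr_ge0// mulrC.
apply: ub_le_sup; last first.
  exists (`|u|^-1 *: u) => //=.
  by rewrite normrZ ger0_norm ?invr_ge0// mulVf ?gt_eqF.
have /linear_boundedP [r [_ gr]] : bounded_near g (nbhs (0 : U)).
  exact: continuous_linear_bounded (@dual_continuous g 0).
have := gr (r + 1); rewrite ltrDl ltr01 => /(_ isT) gr1.
exists (`|r + 1|) => _ [v /= v1 <-].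
apply: (le_trans (gr1 v)); apply: (le_trans (ler_norm _)).
by rewrite normrM ler_piMr// normr_id.
Qed.

Lemma dual_le g u : g u <= dual_norm g * `|u|.
Proof. exact: le_trans (ler_norm _) (dual_norm_bound g u). Qed.

End dual_theory.

(** * Minimisation over closed convex sets *)

Section convex_minimisation.
Context (R : realType) (U : completeNormedModType R) (B : inner_product U).
Implicit Types (C : set U) (g : dual U).

Definition segment_closed (V : lmodType R) (D : set V) := forall t u v,
  0 <= t <= 1 -> D u -> D v -> D (u + t *: (v - u)).

Lemma ip_parallelogram (u v : U) :
  `|u - v| ^+ 2 = `|u| ^+ 2 *+ 2 + `|v| ^+ 2 *+ 2 - `|u + v| ^+ 2.
Proof. by rewrite (ip_sqrB B) (ip_sqrD B); lra. Qed.

(* Near-minimisers [p m] of the norm on [C m] form a Cauchy sequence, by the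
   parallelogram law. *)
Lemma nested_convex_bigcap (C : (set U)^nat) (M : R) :
  (forall m, closed (C m)) -> (forall m, segment_closed (C m)) ->
  (forall m k, (m <= k)%N -> C k `<=` C m) ->
  (forall m, exists2 u, C m u & `|u| <= M) ->
  \bigcap_m C m !=set0.
Proof.
move=> Ccl Ccv Cdec Cbd.
pose S m := [set `|u| ^+ 2 | u in C m]; pose d m := inf (S m).
have S_inf m : has_inf (S m).
  split; last by exists 0 => _ [u _ <-]; exact: sqr_ge0.
  by have [u Cu _] := Cbd m; exists (`|u| ^+ 2), u.
have d_le m u : C m u -> d m <= `|u| ^+ 2.
  by move=> Cu; apply: ge_inf; [case: (S_inf m)|exists u].
have dM m : d m <= M ^+ 2.
  have [u Cu uM] := Cbd m; apply: (le_trans (d_le _ _ Cu)).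
  by rewrite ler_pXn2r ?nnegrE// (le_trans _ uM).
have d_nd : {homo d : n m / (n <= m)%N >-> n <= m}.
  move=> m k mk; apply: lb_le_inf; first by case: (S_inf k).
  by move=> _ [u Cu <-]; apply: d_le; exact: Cdec Cu.
have [d_lim d_gap] := nondecreasing_bounded_gap_cvg0 d_nd dM.
have near_min m : {p | C m p & `|p| ^+ 2 <= d m + m.+1%:R^-1}.
  apply: cid2.
  have m0 : 0 < m.+1%:R^-1 :> R by rewrite invr_gt0 ltr0n.
  by have [_ [p Cp <-] /ltW pd] := inf_adherent m0 (S_inf m); exists p.
pose p m := s2val (near_min m).
have Cp m : C m (p m) by rewrite /p; case: (near_min m).
have pd m : `|p m| ^+ 2 <= d m + m.+1%:R^-1 by rewrite /p; case: (near_min m).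
have p_cvg : cvgn p.
  (* In [2 |p m|^2 + 2 |p k|^2 - |p m + p k|^2] the last term is at least [4 d m], because the
     midpoint lies in [C m]; what remains is at most twice the gap plus four times [1/(m+1)]. *)
  apply: (@sqr_dist_cauchy _ _ _
    (fun m => (limn d - d m) *+ 2 + m.+1%:R^-1 *+ 4)).
    rewrite -[X in _ --> X](addr0 0); apply: cvgD.
      by rewrite -(mul0rn _ 2); apply: cvgMn.
    by rewrite -(mul0rn _ 4); apply: cvgMn; exact: cvg_harmonic.
  move=> m k mk; rewrite ip_parallelogram.
  have : d m <= `|2^-1 *: (p m + p k)| ^+ 2.
    apply: d_le; have -> : 2^-1 *: (p m + p k) = p m + 2^-1 *: (p k - p m).
      have e : p m = 2^-1 *: p m + 2^-1 *: p m.
        by rewrite -scalerDl (_ : _ + _ = 1) ?scale1r//; lra.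
      by rewrite {2}e scalerBr scalerDr addrACA subrr addr0.
    by apply: Ccv; [apply/andP; split; lra|done|exact: Cdec (Cp k)].
  rewrite normrZ ger0_norm ?invr_ge0// exprMn.
  have : k.+1%:R^-1 <= m.+1%:R^-1 :> R by rewrite lef_pV2 ?posrE// ler_nat ltnS.
  have := pd m; have := pd k; have := d_lim k.
  have -> : (2^-1) ^+ 2 = 4^-1 :> R by rewrite exprVn expr2 -natrM.
  move: (limn d) (d k) (d m) (m.+1%:R^-1) (k.+1%:R^-1) => l dk dm hm hk.
  move: (`|p k| ^+ 2) (`|p m| ^+ 2) (`|p m + p k| ^+ 2) => a b c *.
  lra.
exists (limn p) => m _; apply: (closed_cvg (C m) _ _ _ p_cvg) => //.
by exists m => // k /= mk; exact: Cdec (Cp k).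
Qed.

(* The case [C = setT], [y = 0] is the Riesz representation theorem, the case
   [g = 0] the metric projection of [y] onto [C]. *)
Lemma convex_variational C g (y : U) : closed C -> segment_closed C ->
  C !=set0 ->
  exists2 z, C z & forall v, C v -> g (v - z) <= ip B (z - y) (v - z).
Proof.
move=> Ccl Ccv [c0 Cc0].
pose J v := `|v - y| ^+ 2 - g (v - y) *+ 2.
have J_lb v : - dual_norm g ^+ 2 <= J v.
  have := dual_le g (v - y); have := sqr_ge0 (`|v - y| - dual_norm g).
  by rewrite sqrrB /J; lra.
have J_seg t u v :
    J (u + t *: (v - u)) = J u + t * (ip B (u - y) (v - u) - g (v - u)) *+ 2
      + t ^+ 2 * `|v - u| ^+ 2.
  rewrite /J addrAC (ip_sqrD B) linearZr_LR /= dualD dualZ normrZ exprMn.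
  by rewrite real_normK ?num_real//; lra.
pose S := J @` C.
have S_inf : has_inf S.
  by split; [exists (J c0), c0|exists (- dual_norm g ^+ 2) => _ [v _ <-]].
have J_ge v : C v -> inf S <= J v.
  by move=> Cv; apply: ge_inf; [case: S_inf|exists v].
have J_cont : continuous J.
  move=> v; rewrite /J.
  have vy : w - y @[w --> v] --> v - y by apply: cvgB => //; exact: cvg_cst.
  apply: cvgB.
    under eq_fun do rewrite expr2.
    by rewrite expr2; apply: cvgM; apply: cvg_norm.
  apply: cvgMn; apply: (@continuous_comp _ _ _ (fun w => w - y) g) => //.
  exact: dual_continuous.
pose D m := [set v | C v /\ J v <= inf S + m.+1%:R^-1].
(* A point common to all sublevel sets minimises [J] on [C]. The radius comes from completing the
   square: [J v >= (|v - y| - G)^2 - G^2], with [G] the dual norm of [g]. *)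
have [] := @nested_convex_bigcap D
  (`|y| + dual_norm g + 1 + Num.sqrt (`|inf S| + 1 + dual_norm g ^+ 2)).
- move=> m; apply: closedI => //.
  apply: (@closed_comp _ _ J [set r | r <= _]); last exact: closed_le.
  by move=> v _; exact: J_cont.
- move=> m t u v /andP[t0 t1] [Cu Ju] [Cv Jv]; split.
    by apply: Ccv => //; rewrite t0.
  have := J_seg 1 u v; rewrite scale1r addrC subrK => J1.
  rewrite J_seg.
  have : t ^+ 2 * `|v - u| ^+ 2 <= t * `|v - u| ^+ 2.
    by rewrite ler_wpM2r ?sqr_ge0// expr2 ler_piMl.
  have : (1 - t) * J u <= (1 - t) * (inf S + m.+1%:R^-1).
    by rewrite ler_wpM2l// subr_ge0.
  have : t * J v <= t * (inf S + m.+1%:R^-1) by rewrite ler_wpM2l.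
  rewrite J1; move: (ip B _ _ - _) (`|_| ^+ 2) (J u) (inf S + _) => q n j s *.
  lra.
- move=> m k mk v [Cv Jv]; split => //; apply: (le_trans Jv); rewrite lerD2l.
  by rewrite lef_pV2 ?posrE// ler_nat ltnS.
- move=> m.
  have m0 : 0 < m.+1%:R^-1 :> R by rewrite invr_gt0 ltr0n.
  have m1 : m.+1%:R^-1 <= 1 :> R by rewrite invf_le1 ?ler1n.
  have [_ [v Cv <-] /ltW Jv] := inf_adherent m0 S_inf; exists v => //.
  rewrite -(subrK y v); apply: (le_trans (ler_normD _ _)).
  rewrite -!addrA [leRHS]addrC lerD2r !addrA -lerBlDl.
  have [//|] := leP (`|v - y| - (dual_norm g + 1)) 0.
    by move=> /le_trans; apply; exact: sqrtr_ge0.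
  move=> /ltW h0.
  rewrite -(ler_pXn2r (n := 2)) ?nnegrE ?sqrtr_ge0// sqr_sqrtr; last first.
    by rewrite !addr_ge0 ?sqr_ge0.
  have := dual_le g (v - y); have := ler_norm (inf S); move: Jv; rewrite /J.
  move: m1 h0; set a := `|inf S|; set s := inf S; set h := m.+1%:R^-1.
  set x := `|v - y|; set gx : R := g (v - y); set G := dual_norm g.
  clearbody a s h x gx G => *.
  lra.
move=> z Dz; have Cz : C z by have [] := Dz 0%N.
have z_min v : C v -> J z <= J v.
  move=> Cv; apply: (le_trans _ (J_ge v Cv)); apply/ler_addgt0Pr => e e0.
  have [m _ me] := (@cvgrPdist_lt _ _ _ _ _ _ _).1 (@cvg_harmonic R) _ e0.
  have [_ Jz] := Dz m I; apply: (le_trans Jz); rewrite lerD2l.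
  have := me m (leqnn m); rewrite /= sub0r normrN ger0_norm ?invr_ge0//.
  exact: ltW.
exists z => // v Cv; rewrite -subr_ge0 leNgt; apply/negP => lt0.
set q := _ - _ in lt0.
have vz : 0 < `|v - z| ^+ 2.
  rewrite exprn_gt0// normr_gt0; apply: contraTneq lt0 => vz0.
  by rewrite /q vz0 dual0 linear0r subr0 ltxx.
(* The ratio minimises the quadratic [t |-> J (z + t (v - z))], and the cap at 1 keeps the point on
   the segment; the increment of [J] is then at most [t q < 0]. *)
pose t := Num.min 1 (- q / `|v - z| ^+ 2).
have t0 : 0 < t by rewrite lt_min ltr01 divr_gt0// oppr_gt0.
have t1 : t <= 1 by rewrite ge_min lexx.
have tq : t * `|v - z| ^+ 2 <= - q by rewrite -ler_pdivlMr// ge_min lexx orbT.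
have : J z <= J (z + t *: (v - z)).
  by apply: z_min; apply: Ccv => //; rewrite ltW.
rewrite J_seg -/q.
have : t * (t * `|v - z| ^+ 2) <= t * - q by rewrite ler_pM2l.
have : t * q < 0 by rewrite pmulr_rlt0.
rewrite expr2 -mulrA; lra.
Qed.

Lemma riesz g : exists r, forall v, ip B r v = g v.
Proof.
have [z _ gz] := @convex_variational setT g 0 closedT (fun _ _ _ _ _ _ => I)
  (ex_intro _ 0 I).
exists z => v; apply/eqP; rewrite eq_le; apply/andP; split.
  have := gz (z - v) I; rewrite addrAC subrr sub0r subr0 dualN linearNr /=.
  by rewrite lerN2.
by have := gz (z + v) I; rewrite addrAC subrr add0r subr0.
Qed.

End convex_minimisation.

(** * Strongly monotone variational inequalities *)

Section variational_inequality.
Context (R : realType) (U : completeNormedModType R) (B : inner_product U).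
Context (A : U -> dual U).
Hypotheses (A_lip : lipschitz_dual A) (A_strong : strongly_monotone A).

Lemma lipschitz_dual_bound :
  exists2 L, 0 < L & forall u v w, (A u - A v) w <= L * `|u - v| * `|w|.
Proof.
have [C AC] := A_lip; exists (`|C| + 1) => [|u v w]; first by rewrite ltr_wpDl.
apply: (le_trans (dual_le _ _)); rewrite ler_wpM2r// (le_trans (AC u v))//.
by rewrite ler_wpM2r// (le_trans (ler_norm C))// lerDl.
Qed.

(* For small [rho] the map sending [y] to the projection onto [C] of
   [y - rho r], [r] the Riesz representative of [A y - f], is a contraction;
   its fixed point is the solution. *)
Lemma variational_inequality_solvable (f : dual U) (C : set U) :
  closed C -> segment_closed C -> C !=set0 ->
  exists2 y, C y & forall v, C v -> 0 <= (A y - f) (v - y).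
Proof.
move=> Ccl Ccv C0.
have [c c0 Ac] := A_strong; have [L' L'0 AL'] := lipschitz_dual_bound.
(* Enlarging the Lipschitz constant by [c] ensures [c <= L], hence [q2 >= 0]. *)
pose L := L' + c.
have L0 : 0 < L by rewrite addr_gt0.
have cL : c <= L by rewrite lerDr ltW.
have AL u v w : (A u - A v) w <= L * `|u - v| * `|w|.
  by apply: (le_trans (AL' u v w)); rewrite !ler_wpM2r// lerDl ltW.
(* This [rho] minimises [1 - 2 rho c + rho^2 L^2], the squared contraction factor; the minimum is
   [q2]. *)
pose rho := c / L ^+ 2.
have rho0 : 0 < rho by rewrite divr_gt0// exprn_gt0.
pose P y z := C z /\
  forall v, C v -> (- (rho *: (A y - f))) (v - z) <= ip B (z - y) (v - z).
have [S SP] : {S : U -> U & forall y, P y (S y)}.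
  apply: choice => y.
  have [z Cz zP] := convex_variational B (- (rho *: (A y - f))) y Ccl Ccv C0.
  by exists z.
have S_fun : set_fun [set: U] [set: U] S by [].
pose q2 := 1 - c ^+ 2 / L ^+ 2.
have q2_ge0 : 0 <= q2.
  by rewrite subr_ge0 ler_pdivrMr ?exprn_gt0// mul1r ler_pXn2r ?nnegrE// ltW.
have S_contr u v : `|S u - S v| ^+ 2 <= q2 * `|u - v| ^+ 2.
  have [Cu Su] := SP u; have [Cv Sv] := SP v.
  have [r rP] := riesz B (A u - A v).
  have r_le : `|r| <= L * `|u - v|.
    have [->|r0] := eqVneq r 0; first by rewrite normr0 mulr_ge0// ltW.
    have := AL u v r; rewrite -rP ip_norm expr2 ler_pM2r// normr_gt0//.
  (* Each projection inequality is tested with the other projection and the two are added; with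
     Cauchy-Schwarz this makes the projection nonexpansive. *)
  have step : `|S u - S v| ^+ 2 <= ip B ((u - v) - rho *: r) (S u - S v).
    have := Su _ Cv; have := Sv _ Cu.
    rewrite -(ip_norm B) !(dual_oppE, dual_scaleE, dual_subE).
    have := congr1 ( *%R rho) (rP (S u - S v)); rewrite dual_subE !dualB.
    rewrite !ipBl !ipBr !ipZl (ipC B (S v) (S u)).
    clearbody rho => *; lra.
  have S_le : `|S u - S v| <= `|(u - v) - rho *: r|.
    have [->|s0] := eqVneq (S u - S v) 0; first by rewrite normr0.
    have s1 : 0 < `|S u - S v| by rewrite normr_gt0.
    rewrite -(ler_pM2r s1) -expr2; apply: (le_trans step).
    exact: ip_CauchySchwarz.
  have -> : q2 = 1 - rho * c *+ 2 + rho ^+ 2 * L ^+ 2.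
    by rewrite /q2 /rho; field; rewrite gt_eqF.
  apply: (@le_trans _ _ (`|(u - v) - rho *: r| ^+ 2)).
    by rewrite ler_pXn2r ?nnegrE.
  rewrite (ip_sqrB B) ipZr ipC rP normrZ exprMn real_normK ?num_real//.
  have h1 : rho * (c * `|u - v| ^+ 2) <= rho * (A u - A v) (u - v).
    by rewrite ler_pM2l.
  have h2 : rho ^+ 2 * `|r| ^+ 2 <= rho ^+ 2 * (L * `|u - v|) ^+ 2.
    by rewrite ler_pM2l ?exprn_gt0// ler_pXn2r ?nnegrE// mulr_ge0// ltW.
  have e : (L * `|u - v|) ^+ 2 = L ^+ 2 * `|u - v| ^+ 2 by rewrite exprMn.
  rewrite e in h2; move: h1 h2.
  set x : R := (A u - A v) _; clearbody rho x => *; lra.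
have S_is_contr : is_contraction (mkfun S_fun).
  have q0 : 0 <= Num.sqrt q2 by exact: sqrtr_ge0.
  exists (NngNum q0); split=> /=.
    rewrite -sqrtr1 ltr_sqrt// /q2 gtrBl divr_gt0 ?exprn_gt0//.
  move=> [u v] _ /=.
  rewrite -(ler_pXn2r (n := 2)) ?nnegrE ?mulr_ge0 ?sqrtr_ge0//.
  by rewrite exprMn sqr_sqrtr// S_contr.
have [y _ yS] := banach_fixed_point S_is_contr closedT (ex_intro _ 0 I).
have {}yS : y = S y by [].
have [Cy yP] := SP y; rewrite -yS in Cy yP.
exists y => // v Cv; have := yP v Cv.
rewrite dual_oppE dual_scaleE subrr linear0l oppr_le0.
by rewrite pmulr_rge0.
Qed.

(** Testing each inequality with the other solution and adding gives [(A y - A z) (y - z) <= 0],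
    which strong monotonicity allows only for [y = z]. *)
Lemma variational_inequality_unique (f : dual U) (C : set U) y z :
  C y -> (forall v, C v -> 0 <= (A y - f) (v - y)) ->
  C z -> (forall v, C v -> 0 <= (A z - f) (v - z)) -> y = z.
Proof.
move=> Cy yP Cz zP; have [c c0 Ac] := A_strong.
have := yP _ Cz; have := zP _ Cy; have := Ac y z.
rewrite !dual_subE !dualB => h1 h2 h3.
have : c * `|y - z| ^+ 2 <= 0 by lra.
rewrite pmulr_rle0// => yz0; apply/eqP.
by rewrite -subr_eq0 -normr_eq0 -sqrf_eq0 eq_le yz0 sqr_ge0.
Qed.

End variational_inequality.

(** * Order and comparison for obstacle problems *)

Section gelfand_cone.
Context (R : realType) (V H : completeNormedModType R).
Context (T : gelfand_triple V H) (K : lattice_cone T).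
Implicit Types (x y z b : H) (u v w : V).

Lemma cone_ip_ge0 x y : cone K x -> cone K y -> 0 <= ipH T x y.
Proof. by rewrite {1}(cone_selfdual K); apply. Qed.

Lemma cone0 : cone K 0.
Proof. by rewrite cone_selfdual => y _; rewrite linear0l. Qed.

Lemma le_H_refl x : le_H K x x.
Proof. by rewrite /le_H subrr; exact: cone0. Qed.

Lemma le_H_trans y x z : le_H K x y -> le_H K y z -> le_H K x z.
Proof.
by move=> xy yz; rewrite /le_H -(subrK y z) -addrA; exact: cone_add.
Qed.

(** Self-duality makes the cone pointed: the inner product of [y - x] and [x - y] is [- |x - y|^2],
    and it is non-negative. *)
Lemma le_H_anti x y : le_H K x y -> le_H K y x -> x = y.
Proof.
move=> xy yx; apply/eqP; rewrite -subr_eq0; apply/eqP.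
apply: (ip_eq0 (B := ipH T)); rewrite -oppr_ge0.
have := cone_ip_ge0 xy yx.
by rewrite -[y - x]opprB linearNl.
Qed.

Lemma le_H0 x : le_H K 0 x = cone K x.
Proof. by rewrite /le_H subr0. Qed.

Lemma le_H_lim x (u_ : H^nat) (u : H) :
  u_ @ \oo --> u -> (\forall n \near \oo, le_H K x (u_ n)) -> le_H K x u.
Proof.
move=> u_u xu; apply: (@closed_cvg _ _ _ _ (fun n => u_ n - x) _
  (@cone_closed _ _ _ _ K) xu).
by apply: cvgB => //; exact: cvg_cst.
Qed.

Lemma le_H_limr x (u_ : H^nat) (u : H) :
  u_ @ \oo --> u -> (\forall n \near \oo, le_H K (u_ n) x) -> le_H K u x.
Proof.
move=> u_u ux; apply: (@closed_cvg _ _ _ _ (fun n => x - u_ n) _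
  (@cone_closed _ _ _ _ K) ux).
by apply: cvgB => //; exact: cvg_cst.
Qed.

Lemma le_H_ndec (u_ : H^nat) : (forall n, le_H K (u_ n) (u_ n.+1)) ->
  forall n m, (n <= m)%N -> le_H K (u_ n) (u_ m).
Proof.
move=> uS n; elim=> [|m IHm].
  by rewrite leqn0 => /eqP->; exact: le_H_refl.
rewrite leq_eqVlt ltnS => /predU1P[->|/IHm]; first exact: le_H_refl.
by move=> /le_H_trans; exact.
Qed.

Lemma pos_part_id x : cone K x -> pos_part K x = x.
Proof.
move=> Kx; rewrite /pos_part; case: xgetP => [p _ [Kp pmin]|/(_ x)].
  have := pmin x Kx; rewrite subrr normr0 normr_le0 subr_eq0 => /eqP.
  by move->.
by case; split=> // q _; rewrite subrr normr0.
Qed.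

(** Read off from the lattice axioms, since [sup_H K 0 x] is [x^+]. *)
Lemma cone_pos_part x : cone K (pos_part K x).
Proof.
by have [] := cone_sup_ub K 0 x; rewrite /le_H /sup_H subr0 add0r subr0.
Qed.

(** [x] lies below [sup_H K y x = y + (x - y)^+], which is then [y]. *)
Lemma pos_part_eq0 x y : pos_part K (x - y) = 0 -> le_H K x y.
Proof.
by move=> xy0; have [_] := cone_sup_ub K y x; rewrite /sup_H xy0 addr0.
Qed.

Lemma emb_bounded : exists2 C, 0 < C & forall v, `|emb T v| <= C * `|v|.
Proof.
have /linear_boundedP [r [_ er]] : bounded_near (emb T) (nbhs (0 : V)).
  exact: continuous_linear_bounded (@emb_continuous _ _ _ T 0).
exists (`|r| + 1) => [|v]; first by rewrite ltr_wpDl.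
by apply: er; rewrite (le_lt_trans (ler_norm _))// ltrDl.
Qed.

Lemma emb_cvg (u_ : V^nat) u :
  u_ @ \oo --> u -> emb T (u_ n) @[n --> \oo] --> emb T u.
Proof. by move=> u_u; apply: continuous_cvg => //; exact: emb_continuous. Qed.

(* For [0 <= x <= y] self-duality gives [|y - x|^2 <= |y|^2 - |x|^2]. *)
Lemma ndec_bounded_cvg (u_ : H^nat) b : cone K (u_ 0%N) ->
  (forall n, le_H K (u_ n) (u_ n.+1)) -> (forall n, le_H K (u_ n) b) ->
  cvgn u_.
Proof.
move=> u0 uS ub.
have sqr_gap x y : cone K x -> le_H K x y ->
    `|x - y| ^+ 2 <= `|y| ^+ 2 - `|x| ^+ 2.
  move=> Kx xy; have := cone_ip_ge0 Kx xy.
  by rewrite ipBr ip_norm (ip_sqrB (ipH T)) => ?; lra.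
have K_u n : cone K (u_ n).
  by rewrite -le_H0; apply: le_H_trans (le_H_ndec uS (leq0n n)); rewrite le_H0.
have sqr_nd : {homo (fun n => `|u_ n| ^+ 2) : n m / (n <= m)%N >-> n <= m}.
  move=> n m nm /=; rewrite -subr_ge0.
  by apply: le_trans (sqr_gap _ _ (K_u n) (le_H_ndec uS nm)); exact: sqr_ge0.
have [|lim_ub gap0] := nondecreasing_bounded_gap_cvg0 (M := `|b| ^+ 2) sqr_nd.
  move=> n; rewrite -subr_ge0.
  by apply: le_trans (sqr_gap _ _ (K_u n) (ub n)); exact: sqr_ge0.
apply: (sqr_dist_cauchy gap0) => m k mk.
apply: (le_trans (sqr_gap _ _ (K_u m) (le_H_ndec uS mk))).
by rewrite lerD2r lim_ub.
Qed.

Lemma le_dual_H x y : le_H K x y -> le_dual K (H_to_dual T x) (H_to_dual T y).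
Proof.
by move=> xy v Kv; rewrite dual_subE /= -ipBl; exact: cone_ip_ge0.
Qed.

Lemma ipl_cvg (u_ : H^nat) x y :
  u_ @ \oo --> x -> ipH T (u_ n) y @[n --> \oo] --> ipH T x y.
Proof.
move=> /cvgrPdist_le u_x; apply/cvgrPdist_le => e e0.
have y1 : 0 < `|y| + 1 by rewrite ltr_wpDl.
near=> n.
rewrite -ipBl; have d : `|x - u_ n| <= e / (`|y| + 1).
  by near: n; apply: u_x; rewrite divr_gt0.
apply: (@le_trans _ _ (`|x - u_ n| * `|y|)).
  rewrite ler_norml ip_CauchySchwarz andbT lerNl -linearNl /= -(normrN (x - _)).
  exact: ip_CauchySchwarz.
apply: (@le_trans _ _ (e / (`|y| + 1) * (`|y| + 1))).
  by rewrite ler_pM// lerDl.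
by rewrite divfK ?gt_eqF.
Unshelve. all: by end_near. Qed.

(** * Comparison and bounds for the obstacle problem *)

Section obstacle_problem.
Context (A : V -> dual V).
Hypotheses (A_hom : homogeneous1 A) (A_lip : lipschitz_dual A)
  (A_strong : strongly_monotone A) (A_T : T_monotone K A).
Implicit Types (f g : dual V) (psi phi : H).

(** Homogeneity is assumed for positive factors only, so the argument is
    [A 0 = A (2 *: 0) = 2 *: A 0]. *)
Lemma homogeneous1_0 : A 0 = 0.
Proof.
have : A (2 *: 0) = 2 *: A 0 by exact: A_hom.
rewrite scaler0 scaler_nat mulr2n => A0.
by apply: (addrI (A 0)); rewrite -A0 addr0.
Qed.

Lemma obstacle_set_closed psi : closed (obstacle_set K psi).
Proof.
apply: (@closed_comp _ _ (fun v => psi - emb T v) (cone K)) => [v _|].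
  by apply: cvgB; [exact: cvg_cst|exact: emb_continuous].
exact: cone_closed.
Qed.

Lemma obstacle_set_segment_closed psi : segment_closed (obstacle_set K psi).
Proof.
move=> t u v /andP[t0 t1] up vp; rewrite /obstacle_set /= /le_H.
have -> : psi - emb T (u + t *: (v - u)) =
    (1 - t) *: (psi - emb T u) + t *: (psi - emb T v).
  exact: sub_segment.
by apply: cone_add; apply: cone_scale => //; rewrite subr_ge0.
Qed.

Lemma VI_solutionP f psi : cone K psi ->
  le_H K (emb T (VI_solution K A f psi)) psi /\
  forall v, le_H K (emb T v) psi ->
    0 <= (A (VI_solution K A f psi) - f) (v - VI_solution K A f psi).
Proof.
move=> Kpsi; rewrite /VI_solution; case: xgetP => [y _ //|none].
have [|y Cy yP] := variational_inequality_solvable (ipV T) A_lip A_strong f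
  (@obstacle_set_closed psi) (@obstacle_set_segment_closed psi).
  by exists 0; rewrite /obstacle_set /= linear0 le_H0.
by have := none y; case.
Qed.

Lemma VI_solution_eq f psi (y : V) : le_H K (emb T y) psi ->
  (forall v, le_H K (emb T v) psi -> 0 <= (A y - f) (v - y)) ->
  cone K psi -> y = VI_solution K A f psi.
Proof.
move=> ypsi yP Kpsi; have [zpsi zP] := VI_solutionP f Kpsi.
exact: (variational_inequality_unique A_strong ypsi yP zpsi zP).
Qed.

(* Comparison: test with [inf(y, z)] and [sup(y, z)]. *)
Lemma T_monotone_le f g (y z : V) :
  (A y - f) (- posV K (y - z)) >= 0 -> (A z - g) (posV K (y - z)) >= 0 ->
  le_dual K f g -> le_H K (emb T y) (emb T z).
Proof.
move=> yP zP fg; have [A_ge0 [A_eq0 _]] := A_T y z.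
have fgp : 0 <= (g - f) (posV K (y - z)).
  by apply: fg; rewrite emb_posV; exact: cone_pos_part.
apply: pos_part_eq0; rewrite -linearB -emb_posV A_eq0 ?linear0//.
apply/eqP; rewrite eq_le A_ge0 andbT.
move: yP zP fgp; rewrite !dual_subE !dualN; lra.
Qed.

Lemma VI_solution_le f g psi phi : cone K psi -> cone K phi ->
  le_dual K f g -> le_H K psi phi ->
  le_H K (emb T (VI_solution K A f psi)) (emb T (VI_solution K A g phi)).
Proof.
move=> Kpsi Kphi fg psi_phi.
have [] := VI_solutionP f Kpsi; have [] := VI_solutionP g Kphi.
move: (VI_solution _ _ f _) (VI_solution _ _ g _) => y z zphi zP ypsi yP.
apply: (T_monotone_le _ _ fg).
- have := yP (y - posV K (y - z)); rewrite addrAC subrr sub0r; apply.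
  rewrite linearB /= emb_posV linearB /=.
  by apply: le_H_trans ypsi; have [] := cone_inf_lb K (emb T y) (emb T z).
- have := zP (z + posV K (y - z)); rewrite addrAC subrr add0r; apply.
  rewrite linearD /= emb_posV linearB /=.
  by apply: cone_sup_least => //; exact: le_H_trans psi_phi.
Qed.

(** Comparison with the zero solution: as [A 0 = 0], the datum 0 with the same obstacle has solution
    0. *)
Lemma VI_solution_ge0 f psi : cone K psi -> le_dual K 0 f ->
  cone K (emb T (VI_solution K A f psi)).
Proof.
move=> Kpsi f0.
have e : 0 = VI_solution K A 0 psi.
  apply: VI_solution_eq => //; first by rewrite linear0 le_H0.
  by move=> v _; rewrite homogeneous1_0 dual_subE subrr.
rewrite -le_H0 -(linear0 (emb T)) e.
by apply: VI_solution_le => //; exact: le_H_refl.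
Qed.

(** [ybar] solves an equation, so its term in the comparison vanishes and only [inf(y, ybar)] has to
    be feasible. *)
Lemma VI_solution_le_free f F psi (ybar : V) : cone K psi -> A ybar = F ->
  le_dual K f F -> le_H K (emb T (VI_solution K A f psi)) (emb T ybar).
Proof.
move=> Kpsi ybarF fF; have [] := VI_solutionP f Kpsi.
move: (VI_solution _ _ _ _) => y ypsi yP.
apply: (T_monotone_le _ _ fF); last by rewrite ybarF subrr.
have := yP (y - posV K (y - ybar)); rewrite addrAC subrr sub0r; apply.
rewrite linearB /= emb_posV linearB /=.
by apply: le_H_trans ypsi; have [] := cone_inf_lb K (emb T y) (emb T ybar).
Qed.

(** Testing with 0 gives [c |y|^2 <= f y], and [f y <= F y] because [y >= 0]. The 1 added to the
    resulting bound only makes it positive. *)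
Lemma VI_solution_bounded (F : dual V) : exists2 M, 0 < M &
  forall f psi, cone K psi -> le_dual K 0 f -> le_dual K f F ->
    `|VI_solution K A f psi| <= M.
Proof.
have [c c0 Ac] := A_strong.
exists (c^-1 * dual_norm F + 1) => [|f psi Kpsi f0 fF].
  by rewrite ltr_wpDl// mulr_ge0 ?invr_ge0 ?dual_norm_ge0// ltW.
apply: ler_wpDr => //.
have /fF := VI_solution_ge0 Kpsi f0.
have [_ /(_ 0)] := VI_solutionP f Kpsi.
move: (VI_solution _ _ _ _) => y; rewrite linear0 le_H0 => /(_ Kpsi).
have := Ac y 0; rewrite homogeneous1_0 !subr0 sub0r dualN !dual_subE.
move=> Ay Ayf fFy; have Fy := dual_le F y.
have cy : c * `|y| ^+ 2 <= dual_norm F * `|y| by move: Ay Ayf fFy Fy; lra.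
have [->|y0] := eqVneq y 0.
  by rewrite normr0 mulr_ge0 ?invr_ge0 ?dual_norm_ge0// ltW.
rewrite -ler_pdivrMl ?invr_gt0// invrK.
by rewrite -(@ler_pM2r _ `|y|) ?normr_gt0// -mulrA -expr2.
Qed.

End obstacle_problem.

End gelfand_cone.

(** * Weak convergence and order in L^oo *)

Lemma sqr_le_affine_cvg0 (R : realType) (c : R) (e : R^nat) :
  0 < c -> (forall n, 0 <= e n) ->
  (forall eps, 0 < eps ->
    \forall n \near \oo, c * e n ^+ 2 <= eps * (1 + e n)) ->
  e @ \oo --> 0.
Proof.
move=> c0 e0 ce; apply/cvgrPdist_lt => eta eta0.
have eta1 : 0 < 1 + eta by rewrite addr_gt0.
(* Chosen so that [e n >= eta] would give [eps * (1 + e n) <= c * e n ^+ 2 / 2], a contradiction. *)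
pose eps := c * eta ^+ 2 / (2 * (1 + eta)).
have eps0 : 0 < eps by rewrite divr_gt0 ?mulr_gt0 ?exprn_gt0.
have := ce _ eps0; apply: filterS => n cen.
rewrite sub0r normrN ger0_norm// ltNge; apply/negP => en.
have en0 : 0 < e n by exact: lt_le_trans en.
have h1 : eta * (1 + e n) <= e n * (1 + eta) by rewrite !mulrDr !mulr1; lra.
have h2 : eps * (2 * (1 + eta)) = c * eta ^+ 2.
  by rewrite /eps divfK// gt_eqF// mulr_gt0.
have h3 : c * e n ^+ 2 * (2 * (1 + eta)) <= c * eta * (e n * (1 + eta)).
  apply: (@le_trans _ _ (eps * (1 + e n) * (2 * (1 + eta)))).
    by rewrite ler_pM2r// mulr_gt0.
  rewrite mulrAC h2 expr2 !mulrA -[c * eta * eta * _]mulrA -!mulrA.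
  by rewrite ler_pM2l// ler_pM2l.
have h4 : c * eta * (e n * (1 + eta)) <= c * e n * (e n * (1 + eta)).
  by rewrite ler_pM2r ?mulr_gt0// ler_pM2l.
have h5 : 0 < c * e n * (e n * (1 + eta)) by rewrite !mulr_gt0.
have h6 : c * e n ^+ 2 * (2 * (1 + eta)) = c * e n * (e n * (1 + eta)) *+ 2.
  by ring.
by rewrite h6 in h3; lra.
Qed.

Lemma frequently_not_near (P : nat -> Prop) :
  (~ \forall n \near \oo, P n) -> forall N, exists2 n, (N <= n)%N & ~ P n.
Proof.
move=> nP N; apply: contrapT => none; apply: nP; exists N => // n /= Nn.
by apply: contrapT => nPn; apply: none; exists n.
Qed.

Section weak_convergence.
Context (R : realType) (V H : completeNormedModType R).
Context (T : gelfand_triple V H).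

(** Stands in for weak compactness and Mazur's theorem: the points of [C] with image within
    [1/(m+1)] of [h] form nested closed convex sets, each with a member of norm at most [M], so they
    have a common point. *)
Lemma bounded_emb_cvg_in (u_ : V^nat) (M : R) (h : H) (C : set V) :
  (forall n, `|u_ n| <= M) -> emb T (u_ n) @[n --> \oo] --> h ->
  closed C -> segment_closed C ->
  (forall N, exists2 n, (N <= n)%N & C (u_ n)) ->
  exists2 p, C p & emb T p = h.
Proof.
move=> uM /cvgrPdist_lt u_h Ccl Ccv Cu.
pose D m := C `&` [set v | `|h - emb T v| <= m.+1%:R^-1].
have [] := @nested_convex_bigcap _ _ (ipV T) D M.
- move=> m; apply: closedI => //.
  apply: (@closed_comp _ _ (fun v => `|h - emb T v|) [set r | r <= _]).
    move=> v _; apply: cvg_norm; apply: cvgB; first exact: cvg_cst.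
    exact: emb_continuous.
  exact: closed_le.
- move=> m t u v /andP[t0 t1] [Cu1 hu] [Cv hv]; split.
    by apply: Ccv => //; rewrite t0.
  rewrite /=; have -> : h - emb T (u + t *: (v - u)) =
      (1 - t) *: (h - emb T u) + t *: (h - emb T v).
    exact: sub_segment.
  apply: (le_trans (ler_normD _ _)).
  rewrite !normrZ (ger0_norm t0) ger0_norm ?subr_ge0//.
  have t1' : 0 <= 1 - t by rewrite subr_ge0.
  have := ler_wpM2l t0 hv; have := ler_wpM2l t1' hu.
  by move: (m.+1%:R^-1) => b *; lra.
- move=> m k mk v [Cv hv]; split => //; apply: (le_trans hv).
  by rewrite lef_pV2 ?posrE// ler_nat ltnS.
- move=> m; have m0 : 0 < m.+1%:R^-1 :> R by rewrite invr_gt0 ltr0n.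
  have [N _ uN] := u_h _ m0; have [n Nn Cun] := Cu N.
  by exists (u_ n) => //; split => //; apply: ltW; exact: uN.
move=> p Dp; exists p; first by have [] := Dp 0%N I.
apply/eqP; rewrite eq_sym -subr_eq0 -normr_le0; apply/ler_addgt0Pr => e e0.
have /cvgrPdist_lt/(_ _ e0)[m _ me] := @cvg_harmonic R.
have [_ /le_trans] := Dp m I; apply; rewrite add0r.
by have := me m (leqnn m); rewrite /= sub0r normrN ger0_norm// => /ltW.
Qed.

(** If [g (u_ n) >= g u + e] infinitely often, the closed half-space [g >= g u + e] contains a point
    with image [emb T u], which is [u] itself by injectivity: a contradiction. The lower bound
    follows from [- g]. *)
Lemma bounded_emb_weakly_converges (u_ : V^nat) (M : R) (u : V) :
  (forall n, `|u_ n| <= M) -> emb T (u_ n) @[n --> \oo] --> emb T u ->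
  weakly_converges u_ u.
Proof.
move=> uM u_u.
have upper (g : dual V) e : 0 < e -> \forall n \near \oo, g (u_ n) < g u + e.
  move=> e0; apply: contrapT => /frequently_not_near freq.
  have [|||p gp /emb_inj pu] :=
    bounded_emb_cvg_in uM u_u (C :=
      [set v | g u + e <= g v]).
  - apply: (@closed_comp _ _ g [set r | _ <= r]); last exact: closed_ge.
    by move=> v _; exact: dual_continuous.
  - move=> t v w /andP[t0 t1] /= gv gw; rewrite dualD dualZ dualB.
    have : (1 - t) * (g u + e) <= (1 - t) * g v.
      by rewrite ler_wpM2l ?subr_ge0.
    have : t * (g u + e) <= t * g w by rewrite ler_wpM2l.
    set a : R := g u; set b : R := g v; set d : R := g w.
    by clearbody a b d => *; lra.
  - move=> N; have [n Nn /negP] := freq N.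
    by rewrite -leNgt => gn; exists n.
  by move: gp; rewrite /= pu gerDl leNgt e0.
move=> g; apply/cvgrPdist_lt => e e0.
have := upper (- g) _ e0; have := upper g _ e0.
apply: filterS2 => n; rewrite !dual_oppE => h1 h2.
set a : R := g u; set b : R := g (u_ n); rewrite -/a -/b in h1 h2.
by rewrite ltr_norml; apply/andP; split; move: h1 h2; clearbody a b => *; lra.
Qed.

End weak_convergence.

(** * Essentially bounded functions and their order *)

Section Linfty_theory.
Context (R : realType) (N : nat) (Omega : set 'rV[R]_N.+1).
Local Notation mu := (@lebesgueN R N).
Implicit Types z : 'rV[R]_N.+1 -> R.

#[global] Instance lebesgueN_ae_filter : Filter (nbhs (almost_everywhere mu)) :=
  ae_filter_ringOfSetsType mu.

Lemma patch_ae_eq z z' : {ae mu, forall x, Omega x -> z x = z' x} ->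
  {ae mu, forall x, (z \_ Omega) x = (z' \_ Omega) x}.
Proof.
apply: filterS => x zz'; rewrite !patchE; case: ifPn => // xO.
by rewrite zz'//; exact: set_mem.
Qed.

(** Measurability survives a change on a null set because the Caratheodory measure is complete. *)
Lemma in_Linfty_ae z z' : {ae mu, forall x, Omega x -> z x = z' x} ->
  in_Linfty Omega z -> in_Linfty Omega z'.
Proof.
move=> /patch_ae_eq zz' /andP[]; rewrite !inE /= => mz fz.
apply/andP; split; rewrite inE /=.
  apply/measurable_EFinP.
  apply: (@ae_measurable_fun _ _ _ mu _ setT (EFin \o (z \_ Omega))).
  - exact: measure_is_complete_caratheodory.
  - by apply: filterS zz' => x /= -> _.
  - exact/measurable_EFinP.
move: fz; rewrite /finite_norm unlock /Lnorm; case: ifP => // _.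
rewrite (@eq_ess_sup _ _ _ mu _ (abse \o (EFin \o (z' \_ Omega))))//.
by apply: filterS zz' => x /= ->.
Qed.

Lemma in_LinftyD (a : R) z z' : in_Linfty Omega z -> in_Linfty Omega z' ->
  in_Linfty Omega (fun x => a * z x + z' x).
Proof.
move=> zL z'L; rewrite /in_Linfty.
have -> : (fun x => a * z x + z' x) \_ Omega = a *: (z \_ Omega) + z' \_ Omega.
  apply/funext => x; rewrite !fctE !patchE; case: ifPn => // _.
  by rewrite scaler0 addr0.
have [_] := Lfun_submod_closed mu (leey 1%E); exact.
Qed.

Lemma Linfty_norm_lt_ae (e : R) z : (Linfty_norm Omega z < e%:E)%E ->
  {ae mu, forall x, Omega x -> `|z x| <= e}.
Proof.
rewrite /Linfty_norm unlock /Lnorm; case: ifPn => [_ /ltW/ess_supP|mu0 _].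
  apply: filterS => x /=; rewrite patchE => + xO.
  by rewrite mem_set// lee_fin.
(* Here the whole space is null and serves as the exceptional set. *)
exists setT; split => //.
by apply/eqP; rewrite eq_le measure_ge0 andbT leNgt.
Qed.

End Linfty_theory.

Section function_space_order.
Context (R : realType) (V H : completeNormedModType R).
Context (T : gelfand_triple V H) (K : lattice_cone T).
Context (N : nat) (Omega : set 'rV[R]_N.+1) (E : function_space K Omega).
Context (nu : R) (nu_gt0 : 0 < nu).
Local Notation mu := (@lebesgueN R N).

(** The lower bound [nu] turns a uniform error into a relative one: [k - (1 - e) h = (k - h) + e h
    >= - e nu + e nu]. *)
Lemma Linfty_nu_close_le (e : R) (h k : H) : 0 <= e ->
  in_Linfty_nu Omega nu (rep E h) -> in_Linfty_nu Omega nu (rep E k) ->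
  {ae mu, forall x, Omega x -> `|rep E h x - rep E k x| <= e * nu} ->
  le_H K ((1 - e) *: h) k.
Proof.
move=> e0 [hL hnu] [kL _] hk; rewrite /le_H addrC -scaleNr.
have repE := rep_linear E (- (1 - e)) h k.
have kL' : in_Linfty Omega (rep E (- (1 - e) *: h + k)).
  apply: in_Linfty_ae (in_LinftyD (- (1 - e)) hL kL).
  by apply: filterS repE => x xE xO; rewrite xE.
apply/(Linfty_order kL').
move: hnu hk repE; apply: filterS3 => x hx hkx xE xO; rewrite xE//.
have := ler_wpM2l e0 (hx xO); have := hkx xO; rewrite ler_norml => /andP[_].
lra.
Qed.

Lemma Linfty_nu_cvg_close_le (h_ : H^nat) (h : H) :
  converges_in_Linfty_nu E nu h_ h -> forall e, 0 < e ->
  \forall n \near \oo, le_H K ((1 - e) *: h) (h_ n) /\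
                       le_H K ((1 - e) *: h_ n) h.
Proof.
move=> [h_L hL h_h] e e0.
have : nbhs (0%E : \bar R) [set y : \bar R | (y < (e * nu)%:E)%E].
  by apply: (@open_ereal_lt' _ 0%E (e * nu)%:E); rewrite lte_fin mulr_gt0.
move=> /h_h [m _ mP]; exists m => // n /mP /Linfty_norm_lt_ae close.
split.
  apply: (Linfty_nu_close_le (ltW e0) hL (h_L n)).
  by apply: filterS close => x xe xO; rewrite distrC xe.
exact: (Linfty_nu_close_le (ltW e0) (h_L n) hL).
Qed.

End function_space_order.

(** * Dependence on the obstacle *)

Section obstacle_stability.
Context (R : realType) (V H : completeNormedModType R).
Context (T : gelfand_triple V H) (K : lattice_cone T).
Context (A : V -> dual V).
Hypotheses (A_hom : homogeneous1 A) (A_lip : lipschitz_dual A)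
  (A_strong : strongly_monotone A) (A_T : T_monotone K A).
Context (F : dual V).

(** The inequality for [z_ n] is tested near [z] and the one for [z] near [z_ n]. By strong
    monotonicity their sum yields [c |z_ n - z|^2 <= e (1 + |z_ n - z|)] for large [n]. *)
Lemma VI_solution_stable (f_ : H^nat) (f : H) (psi_ : H^nat) (psi : H) :
  f_ @ \oo --> f ->
  (forall n, le_dual K 0 (H_to_dual T (f_ n)) /\
             le_dual K (H_to_dual T (f_ n)) F) ->
  (forall n, cone K (psi_ n)) -> cone K psi ->
  let z_ n := VI_solution K A (H_to_dual T (f_ n)) (psi_ n) in
  let z := VI_solution K A (H_to_dual T f) psi in
  (forall e, 0 < e -> \forall n \near \oo,
    (exists2 v, le_H K (emb T v) (psi_ n) & `|v - z| <= e) /\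
    (exists2 v, le_H K (emb T v) psi & `|v - z_ n| <= e)) ->
  z_ @ \oo --> z.
Proof.
move=> f_f f_F Kpsi_ Kpsi z_ z recovery.
have [c c0 Ac] := A_strong; have [L L0 AL] := lipschitz_dual_bound A_lip.
have [M M0 zM] := VI_solution_bounded A_hom A_lip A_strong A_T F.
have {}zM n : `|z_ n| <= M by have [? ?] := f_F n; exact: zM.
have [C C0 TC] := emb_bounded T.
have H_dualC (h : H) v : ipH T h (emb T v) <= C * `|h| * `|v|.
  apply: (le_trans (ip_CauchySchwarz _ _ _)); rewrite mulrAC mulrC.
  by rewrite ler_wpM2r.
(* For large [n], [D] dominates the sum of the norms of the residuals [A (z_ n) - f_ n] and
   [A z - f], so recovery within [e / D] costs at most [e] in total. *)
pose D := L * M + C * (`|f| + 1) + dual_norm (A z - H_to_dual T f) + 1.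
have D0 : 0 < D.
  by rewrite /D ltr_wpDl// !addr_ge0 ?dual_norm_ge0// mulr_ge0// ltW.
apply: dist_cvg0; apply: (sqr_le_affine_cvg0 c0) => [n|e e0].
  exact: normr_ge0.
have eD : 0 < e / D by rewrite divr_gt0.
have eC : 0 < e / C by rewrite divr_gt0.
have /cvgrPdist_le/(_ _ eC) f_close := f_f.
have /cvgrPdist_le/(_ _ ltr01) f_bd := f_f.
have := recovery _ eD; apply: filterS3 f_close f_bd => n fe f1.
move=> [[v vpsi vz] [w wpsi wz]].
have [_ /(_ v vpsi) zv] :=
  VI_solutionP A_lip A_strong (H_to_dual T (f_ n)) (Kpsi_ n).
have [_ /(_ w wpsi) zw] :=
  VI_solutionP A_lip A_strong (H_to_dual T f) Kpsi.
rewrite -/(z_ n) -/z in zv zw.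
have f_n : `|f_ n| <= `|f| + 1.
  rewrite -[f_ n](subrK f) addrC (le_trans (ler_normD _ _))// lerD2l.
  by rewrite distrC.
have h1 : (A (z_ n) - H_to_dual T (f_ n)) (v - z) <=
    (L * M + C * (`|f| + 1)) * (e / D).
  rewrite dual_subE mulrDl; apply: lerD.
    have := AL (z_ n) 0 (v - z); rewrite homogeneous1_0// !subr0.
    by move=> /le_trans; apply; rewrite !ler_pM// ?mulr_ge0// ?ler_pM2l// ltW.
  rewrite -[X in X <= _]/(- ipH T (f_ n) (emb T (v - z))).
  rewrite -linearNr /= -linearN /=.
  apply: (le_trans (H_dualC _ _)); rewrite normrN.
  by rewrite !ler_pM// ?mulr_ge0// ?ler_pM2l// ltW.
have h2 : (A z - H_to_dual T f) (w - z_ n) <=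
    dual_norm (A z - H_to_dual T f) * (e / D).
  by apply: (le_trans (dual_le _ _)); rewrite ler_wpM2l// dual_norm_ge0.
have h3 : (H_to_dual T (f_ n) - H_to_dual T f) (z_ n - z) <=
    e * `|z_ n - z|.
  rewrite dual_subE /= -ipBl; apply: (le_trans (H_dualC _ _)).
  by rewrite ler_wpM2r// mulrC -ler_pdivlMr// distrC.
have h4 : D * (e / D) = e by rewrite mulrC divfK// gt_eqF.
have h5 : (L * M + C * (`|f| + 1)) * (e / D) +
    dual_norm (A z - H_to_dual T f) * (e / D) <= e.
  by rewrite -mulrDl -[leRHS]h4 ler_wpM2r ?(ltW eD)// /D lerDl.
have := Ac (z_ n) z.
move: zv zw h1 h2 h3 h5; rewrite !dual_subE !dualB.
move: (`|z_ n - z|) (dual_norm _ * _) (_ * (e / D)) => d r s.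
set a1 : R := A (z_ n) v; set a2 : R := A (z_ n) (z_ n).
set a3 : R := A (z_ n) z; set a4 : R := A z w; set a5 : R := A z (z_ n).
set a6 : R := A z z; set b1 : R := H_to_dual T (f_ n) v.
set b2 : R := H_to_dual T (f_ n) (z_ n); set b3 : R := H_to_dual T (f_ n) z.
set b4 : R := H_to_dual T f w; set b5 : R := H_to_dual T f (z_ n).
set b6 : R := H_to_dual T f z.
by clearbody a1 a2 a3 a4 a5 a6 b1 b2 b3 b4 b5 b6 => *; lra.
Qed.

(** * Recovery of obstacles under the assumption on [Phi] *)

Context (N : nat) (Omega : set 'rV[R]_N.+1) (E : function_space K Omega).
Context (nu : R) (nu_gt0 : 0 < nu).
Context (Phi : H -> H).
Hypotheses (Phi_incr : increasing_on_cone K Phi)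
  (Phi_A : assumption_A E nu Phi).

Lemma cone_extend (x : H) : cone K (extend K Phi x).
Proof. by apply: (Phi_incr.1); exact: cone_pos_part. Qed.

Lemma extend_le (x y : H) : cone K x -> le_H K x y ->
  le_H K (extend K Phi x) (extend K Phi y).
Proof.
move=> Kx xy; have Ky : cone K y.
  by rewrite -le_H0; apply: le_H_trans xy; rewrite le_H0.
by rewrite /extend !pos_part_id//; exact: Phi_incr.2.
Qed.

(* With [w_ n], [w] the obstacles, [Q (w_ n) >= 0] and [w_ n <= w] bound
   [Q (w_ n) (w_ n)] by [Q (w_ n) w]: this gives boundedness of [w_], hence weak
   convergence, and then [c |w_ n - w|^2 <= Q w (w - w_ n)] tends to 0. *)
Lemma assumption_b_cvg_V (y_ : V^nat) (y : V) : assumption_b K Phi ->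
  weakly_converges y_ y -> (forall n, cone K (emb T (y_ n))) ->
  (forall n, le_H K (emb T (y_ n)) (emb T y)) ->
  converges_in_V T (fun n => extend K Phi (emb T (y_ n)))
    (extend K Phi (emb T y)).
Proof.
move=> [Phi_cvg [Q [[C QC] [c c0 Qc] _ PhiQ]]] y_y Ky_ yy.
have Ky : cone K (emb T y).
  by rewrite -le_H0; apply: le_H_trans (yy 0%N); rewrite le_H0.
have [w_ w_P] : {w_ : V^nat & forall n,
    emb T (w_ n) = Phi (emb T (y_ n)) /\ le_dual K 0 (Q (w_ n))}.
  by apply: (@choice _ _ (fun n w => emb T w = Phi (emb T (y_ n)) /\
    le_dual K 0 (Q w))) => n; have [w ? ?] := PhiQ _ (Ky_ n); exists w.
have [w wPhi _] := PhiQ _ Ky.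
have extE n : extend K Phi (emb T (y_ n)) = emb T (w_ n).
  by rewrite /extend pos_part_id//; have [] := w_P n.
have extEy : extend K Phi (emb T y) = emb T w by rewrite /extend pos_part_id.
have Qw n : Q (w_ n) (w_ n) <= Q (w_ n) w.
  rewrite -subr_ge0 -dualB; have [_ /(_ (w - w_ n))] := w_P n.
  rewrite subr0; apply; rewrite linearB /= -extE -extEy.
  exact: extend_le.
have w_bd n : `|w_ n| <= c^-1 * (`|C| * `|w|).
  rewrite -ler_pdivrMl ?invr_gt0// invrK.
  have [->|w0] := eqVneq (w_ n) 0; first by rewrite normr0 mulr0 mulr_ge0.
  have wn0 : 0 < `|w_ n| by rewrite normr_gt0.
  rewrite -(ler_pM2r wn0) -mulrA -expr2.
  have := Qc (w_ n) 0;  rewrite (linear0 Q) !subr0 => /le_trans; apply.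
  apply: (le_trans (Qw n)); apply: (le_trans (dual_le _ _)).
  rewrite mulrAC ler_wpM2r// (le_trans (QC _))// ler_wpM2r//.
  exact: ler_norm.
have w_w : emb T (w_ n) @[n --> \oo] --> emb T w.
  have := Phi_cvg _ _ y_y; rewrite extEy.
  by under eq_fun do rewrite extE.
have /(_ (Q w))/cvgrPdist_le Qw_w := bounded_emb_weakly_converges w_bd w_w.
exists w_, w; split => //.
apply: dist_cvg0; apply: (sqr_le_affine_cvg0 c0) => [n|e e0].
  exact: normr_ge0.
have := Qw_w _ e0; apply: filterS => n /(le_trans (ler_norm _)) Qe.
apply: (le_trans (Qc _ _)); rewrite dual_subE !dualB.
have : 0 <= e * `|w_ n - w| by rewrite mulr_ge0// ltW.
have := Qw n; move: Qe; rewrite mulrDr mulr1; set p := e * `|_|.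
set a : R := Q w w; set b : R := Q w (w_ n); set d : R := Q (w_ n) w.
set g : R := Q (w_ n) (w_ n).
by clearbody a b d g p => *; lra.
Qed.


(** Boundedness turns convergence in [H] into weak convergence in [V], on which the assumption acts;
    positivity and [y_ n <= y] enter through case (b). *)
Lemma VI_solution_extend_cvg (f_ : H^nat) (f : H) (y_ : V^nat) (y : V) (B : R) :
  f_ @ \oo --> f ->
  (forall n, le_dual K 0 (H_to_dual T (f_ n)) /\
             le_dual K (H_to_dual T (f_ n)) F) ->
  (forall n, `|y_ n| <= B) -> emb T (y_ n) @[n --> \oo] --> emb T y ->
  (forall n, cone K (emb T (y_ n))) ->
  (forall n, le_H K (emb T (y_ n)) (emb T y)) ->
  VI_solution K A (H_to_dual T (f_ n)) (extend K Phi (emb T (y_ n)))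
    @[n --> \oo] -->
  VI_solution K A (H_to_dual T f) (extend K Phi (emb T y)).
Proof.
move=> f_f f_F yB y_y Ky_ yy.
have y_weak := bounded_emb_weakly_converges yB y_y.
have Kpsi_ n := cone_extend (emb T (y_ n)).
have Kpsi := cone_extend (emb T y).
have : converges_in_Linfty_nu E nu (fun n => extend K Phi (emb T (y_ n)))
      (extend K Phi (emb T y)) \/
    converges_in_V T (fun n => extend K Phi (emb T (y_ n)))
      (extend K Phi (emb T y)).
  case: Phi_A => [Phi_a|Phi_b]; first exact: Phi_a.
  by right; exact: assumption_b_cvg_V.
move=> psi_cvg; apply: (VI_solution_stable f_f f_F Kpsi_ Kpsi) => e e0.
have [zpsi _] := VI_solutionP A_lip A_strong (H_to_dual T f) Kpsi.
have z_psi n := (VI_solutionP A_lip A_strong (H_to_dual T (f_ n)) (Kpsi_ n)).1.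
case: psi_cvg => [psi_cvg|[w_ [w [w_psi wpsi /cvgrPdist_le/(_ _ e0)]]]].
  have [M M0 zM] := VI_solution_bounded A_hom A_lip A_strong A_T F.
  set z := VI_solution K A (H_to_dual T f) _ in zpsi *.
  (* [S] bounds [z] and all the approximating solutions, so with [d <= e / S] scaling by [1 - d]
     moves them by at most [e]; [d <= 1] keeps the factor non-negative, hence order-preserving. *)
  pose S := M + `|z| + 1.
  have S0 : 0 < S by rewrite ltr_wpDl// addr_ge0// ltW.
  pose d := Num.min 1 (e / S).
  have d0 : 0 < d by rewrite lt_min ltr01 divr_gt0.
  have d1 : d <= 1 by rewrite ge_min lexx.
  have dS (v : V) : `|v| <= S -> `|(1 - d) *: v - v| <= e.
    move=> vS; rewrite scalerBl scale1r addrAC subrr sub0r normrN normrZ.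
    rewrite gtr0_norm//; apply: (@le_trans _ _ (e / S * S)).
      by apply: ler_pM => //; [exact: ltW|rewrite ge_min lexx orbT].
    by rewrite divfK// gt_eqF.
  have d01 : 0 <= 1 - d by rewrite subr_ge0.
  have scaled (v : V) (x x' : H) : le_H K (emb T v) x ->
      le_H K ((1 - d) *: x) x' -> le_H K (emb T ((1 - d) *: v)) x'.
    move=> vx; apply: le_H_trans; rewrite linearZ /= /le_H -scalerBr.
    exact: cone_scale.
  have := Linfty_nu_cvg_close_le nu_gt0 psi_cvg d0.
  apply: filterS => n [psi_n n_psi]; split.
    exists ((1 - d) *: z); first exact: scaled psi_n.
    by apply: dS; rewrite /S -addrA addrCA lerDl addr_ge0// ltW.
  exists ((1 - d) *: VI_solution K A (H_to_dual T (f_ n))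
      (extend K Phi (emb T (y_ n)))); first exact: scaled (z_psi n) n_psi.
  apply: dS; have [? ?] := f_F n.
  by rewrite /S -addrA ler_wpDr ?addr_ge0// zM.
apply: filterS => n ww; move: zpsi (z_psi n).
move: (VI_solution _ _ _ _) (VI_solution _ _ _ _) => zn z.
rewrite -w_psi -wpsi => zw znw.
(* Translation by the difference of the obstacles turns [z <= w] into [z + (w_ n - w) <= w_ n], and
   symmetrically for [zn]. *)
split.
  exists (z + (w_ n - w)); last by rewrite addrAC subrr add0r distrC.
  rewrite /le_H linearD linearB /= opprD opprB.
  by rewrite addrCA (addrC (emb T (w_ n))) subrK addrC.
exists (zn + (w - w_ n)); last by rewrite addrAC subrr add0r.
rewrite /le_H linearD linearB /= opprD opprB.
by rewrite addrCA (addrC (emb T w)) subrK addrC.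
Qed.

(** The order bound gives convergence in [H]; the norm bound in [V] places the limit in the range of
    the embedding. *)
Lemma ndec_bounded_emb_cvg (y_ : V^nat) (b : H) (B : R) :
  (forall n, `|y_ n| <= B) -> cone K (emb T (y_ 0%N)) ->
  (forall n, le_H K (emb T (y_ n)) (emb T (y_ n.+1))) ->
  (forall n, le_H K (emb T (y_ n)) b) ->
  exists y : V, [/\ emb T (y_ n) @[n --> \oo] --> emb T y,
    forall n, le_H K (emb T (y_ n)) (emb T y) & le_H K (emb T y) b].
Proof.
move=> yB y0 yS yb; have h_cvg := ndec_bounded_cvg y0 yS yb.
have [|||y _ yh] := bounded_emb_cvg_in (C := setT) yB h_cvg.
- exact: closedT.
- by [].
- by move=> n; exists n.
exists y; rewrite yh; split => //.
  move=> n; apply: (le_H_lim h_cvg); exists n => // m /= nm.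
  exact: (le_H_ndec yS).
by apply: (le_H_limr h_cvg); exact: nearW.
Qed.

(** * Smallest fixed points by iteration *)

Context (ybar : V) (ybar_sol : A ybar = F).

Definition admissible (g : H) :=
  le_dual K 0 (H_to_dual T g) /\ le_dual K (H_to_dual T g) F.

(* The iterates of [y |-> S(g, Phi y)] from 0 increase to a fixed point. *)
Lemma fixed_point_exists (g : H) : admissible g ->
  exists2 y, fixed_points K A Phi ybar (H_to_dual T g) y &
    forall g' z, le_H K g g' -> fixed_points K A Phi ybar (H_to_dual T g') z ->
      le_H K (emb T y) (emb T z).
Proof.
move=> [g0 gF].
pose S y := VI_solution K A (H_to_dual T g) (extend K Phi (emb T y)).
pose y_ k := iter k S 0.
have KS y : cone K (emb T (S y)).
  by apply: VI_solution_ge0 => //; exact: cone_extend.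
have Ky k : cone K (emb T (y_ k)).
  by case: k => [|k] /=; [rewrite linear0; exact: cone0|exact: KS].
have yS k : le_H K (emb T (y_ k)) (emb T (y_ k.+1)).
  elim: k => [|k IHk]; first by rewrite /= linear0 le_H0; exact: KS.
  apply: VI_solution_le => //; try exact: cone_extend.
    by apply: le_dual_H; exact: le_H_refl.
  exact: extend_le.
have Sb y : le_H K (emb T (S y)) (emb T ybar).
  exact: (VI_solution_le_free A_lip A_strong A_T (cone_extend _) ybar_sol gF).
have yb k : le_H K (emb T (y_ k)) (emb T ybar).
  by apply: le_H_trans (yS k) _; exact: Sb.
have [M M0 zM] := VI_solution_bounded A_hom A_lip A_strong A_T F.
have yM k : `|y_ k| <= M.
  case: k => [|k] /=; first by rewrite normr0 ltW.
  by apply: zM => //; exact: cone_extend.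
have [y [y_y yy y_le]] := ndec_bounded_emb_cvg yM (Ky 0%N) yS yb.
have yfix : y = S y.
  apply: (@emb_inj _ _ _ T).
  have SyS : S (y_ k) @[k --> \oo] --> S y.
    exact: (VI_solution_extend_cvg (cvg_cst g) _ yM y_y Ky yy).
  (* As [y_ k.+1 = S (y_ k)], the shifted sequence converges in [H] to both [y] and [S y]. *)
  have y_yS := y_y; rewrite -(cvg_shiftS (fun k => emb T (y_ k))) in y_yS.
  exact: (norm_cvg_unique y_yS (emb_cvg SyS)).
exists y.
  split=> //; first by rewrite le_H0 yfix; exact: KS.
(* Every iterate stays below [z], by induction. Allowing [g' >= g] gives minimality ([g' = g]) and
   monotonicity in the datum at once. *)
move=> g' z gg' [z0 _ zfix]; apply: (le_H_limr y_y); apply: nearW.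
elim=> [|k IHk]; first by rewrite /= linear0.
rewrite zfix; apply: VI_solution_le => //; try exact: cone_extend.
  exact: le_dual_H.
exact: extend_le.
Qed.

Lemma smallest_fixed_pointP (g : H) : admissible g ->
  fixed_points K A Phi ybar (H_to_dual T g)
    (smallest_fixed_point K A Phi ybar (H_to_dual T g)) /\
  forall g' z, le_H K g g' -> fixed_points K A Phi ybar (H_to_dual T g') z ->
    le_H K (emb T (smallest_fixed_point K A Phi ybar (H_to_dual T g)))
      (emb T z).
Proof.
move=> /fixed_point_exists[y yfix ymin].
rewrite /smallest_fixed_point; case: xgetP => [p _ [pfix pmin]|/(_ y)].
  split=> // g' z gg' zfix; apply: (le_H_trans (pmin y yfix)).
  exact: ymin gg' zfix.
case; split=> // z; exact: (ymin g z (le_H_refl _ _)).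
Qed.

End obstacle_stability.

(** * Convergence of the smallest fixed points *)

Theorem lemma3 (R : realType) (V H : completeNormedModType R)
    (T : gelfand_triple V H) (K : lattice_cone T)
    (N : nat) (Omega : set 'rV[R]_N.+1) (Omega_open : open Omega)
    (E : function_space K Omega) (nu : R) (nu_gt0 : 0 < nu)
    (A : V -> dual V) (A_hom : homogeneous1 A) (A_lip : lipschitz_dual A)
    (A_strong : strongly_monotone A) (A_T : T_monotone K A)
    (F : dual V) (F_ge0 : le_dual K 0 F)
    (ybar : V) (ybar_sol : A ybar = F)
    (Phi : H -> H) (Phi_incr : increasing_on_cone K Phi)
    (f_ : nat -> H) (fstar : H)
    (f_pos : forall n, cone K (f_ n))
    (f_bounds : forall n, le_dual K 0 (H_to_dual T (f_ n)) /\
                          le_dual K (H_to_dual T (f_ n)) F)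
    (f_ndec : forall n, le_H K (f_ n) (f_ n.+1))
    (f_cvg : f_ n @[n --> \oo] --> fstar)
    (Phi_A : assumption_A E nu Phi) :
  let m f := smallest_fixed_point K A Phi ybar (H_to_dual T f) in
  increases_to K (fun n => emb T (m (f_ n))) (emb T (m fstar)) /\
  m (f_ n) @[n --> \oo] --> m fstar.
Proof.
move=> m.
have f_le n : le_H K (f_ n) fstar.
  by apply: (le_H_lim f_cvg); exists n => // k /= nk; exact: le_H_ndec.
have fstar_adm : admissible K F fstar.
  split=> v Kv; rewrite dual_subE.
    apply: (@closed_cvg _ _ \oo _ (fun n => ipH T (f_ n) (emb T v)) _
      (@closed_ge R 0)); last by rewrite subr0; exact: ipl_cvg.
    by apply: nearW => n /=; have [/(_ v Kv)] := f_bounds n; rewrite subr0.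
  rewrite subr_ge0.
  apply: (@closed_cvg _ _ \oo _ (fun n => ipH T (f_ n) (emb T v)) _
    (@closed_le R (F v))); last exact: ipl_cvg.
  by apply: nearW => n /=; have [_ /(_ v Kv)] := f_bounds n; rewrite subr_ge0.
have mP :=
  smallest_fixed_pointP A_hom A_lip A_strong A_T nu_gt0 Phi_incr Phi_A ybar_sol.
have [[mstar0 mstar_b mstar_fix] mstar_min] := mP _ fstar_adm.
have m_fix n := (mP _ (f_bounds n)).1.
have m_min n := (mP _ (f_bounds n)).2.
have m_eq n : m (f_ n) =
    VI_solution K A (H_to_dual T (f_ n)) (extend K Phi (emb T (m (f_ n)))).
  by have [] := m_fix n.
have mS n : le_H K (emb T (m (f_ n))) (emb T (m (f_ n.+1))).
  exact: m_min (f_ndec n) (m_fix n.+1).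
have m_le n : le_H K (emb T (m (f_ n))) (emb T (m fstar)).
  by apply: m_min (f_le n) _.
have Km n : cone K (emb T (m (f_ n))) by rewrite -le_H0; have [] := m_fix n.
have [M M0 zM] := VI_solution_bounded A_hom A_lip A_strong A_T F.
have mM n : `|m (f_ n)| <= M.
  have [? ?] := f_bounds n.
  by rewrite m_eq; apply: zM => //; exact: cone_extend.
(* Taking [m fstar] rather than [ybar] as the upper bound already yields [y <= m fstar]; the
   converse will come from minimality once [y] is a fixed point. *)
have [y [y_cvg yy y_le]] := ndec_bounded_emb_cvg mM (Km 0%N) mS m_le.
have m_cvg : m (f_ n) @[n --> \oo] -->
    VI_solution K A (H_to_dual T fstar) (extend K Phi (emb T y)).
  rewrite (funext m_eq).
  exact: (VI_solution_extend_cvg A_hom A_lip A_strong A_T nu_gt0 Phi_incr Phi_A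
    f_cvg f_bounds mM y_cvg Km yy).
(* Both are limits of the same sequence in [H]; this also upgrades the convergence to [y] from [H]
   to [V]. *)
have yfix : y = VI_solution K A (H_to_dual T fstar) (extend K Phi (emb T y)).
  apply: (@emb_inj _ _ _ T).
  exact: (norm_cvg_unique y_cvg (emb_cvg m_cvg)).
have ym : y = m fstar.
  apply: (@emb_inj _ _ _ T); apply: (le_H_anti y_le).
  apply: (mstar_min fstar y (le_H_refl _ _)); split => //.
    by rewrite le_H0 -le_H0; apply: le_H_trans (yy 0%N); rewrite le_H0.
  exact: le_H_trans y_le mstar_b.
by rewrite -yfix ym in m_cvg; rewrite ym in y_cvg.
Qed.
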